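(* The measure $\mu$ is concentrated on the set $\Phi_0\subset\Phi$ of distributions of the form $$\xi=\sum_i c^i\,\delta_{x_i},\qquad c^i=(c^i_1,\dots,c^i_{n-1})\in\mathbb R^{n-1},\quad x_i\in X,\qquad\text{where }\sum_i|c^i|<\infty.$$
   Context: Let $n\ge2$ and let $X$ be a smooth manifold with a finite continuous (non-atomic) measure $m$. Let $F$ be the space of smooth bounded $\mathbb R^{n-1}$-valued functions on $X$ and $\Phi$ its dual, the space of vector distributions $\xi=(\xi_1,\dots,\xi_{n-1})$ on $X$ with the ordinary topology, with pairing $\langle\xi,\gamma\rangle=\sum_{k=1}^{n-1}\langle\xi_k,\gamma_k\rangle$. The vector distribution $c\,\delta_{x_0}$, $c\in\mathbb R^{n-1}$, acts by $\langle c\,\delta_{x_0},\gamma\rangle=\sum_kc_k\gamma_k(x_0)$. The measure $\mu$ is the probability measure on $\Phi$ (which exists by the Minlos theorem) whose Fourier transform is $$\int_\Phi e^{i\langle\xi,\gamma\rangle}d\mu(\xi)=\exp\Bigl(-\tfrac12\int_X\log\bigl(1+\tfrac14|\gamma(x)|^2\bigr)\,dm(x)\Bigr),\qquad\gamma\in F.$$ *)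

(* Defs.v *)
From HB Require Import structures.
From mathcomp Require Import all_boot all_order all_algebra.
From mathcomp Require Import all_classical all_reals all_analysis.
From mathcomp Require Import complex.

Set Implicit Arguments.
Unset Strict Implicit.
Unset Printing Implicit Defensive.

Import Order.TTheory GRing.Theory Num.Theory.
Import numFieldNormedType.Exports.

Local Open Scope classical_set_scope.
Local Open Scope ring_scope.

(* The norm of ['rV[R]_p] in the library is the sup norm. *)
Definition sqnorm2 {R : realType} {p : nat} (v : 'rV[R]_p) : R :=
  \sum_(k < p) v 0 k ^+ 2.

Definition norm2 {R : realType} {p : nat} (v : 'rV[R]_p) : R :=
  Num.sqrt (sqnorm2 v).

Section smooth_maps.
Context {R : realType} {d : nat}.
Implicit Types (U : set 'rV[R]_d) (f : 'rV[R]_d -> R) (s : seq 'I_d).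

Fixpoint pderiv s f : 'rV[R]_d -> R :=
  if s is i :: s' then fun x => 'D_(delta_mx 0 i) (pderiv s' f) x else f.

(* Only meaningful for open [U], as ['D_v] is a two-sided derivative. *)
Definition smooth_on U f := forall s x, U x ->
  {for x, continuous (pderiv s f)} /\
  forall i, derivable (pderiv s f) x (delta_mx 0 i).

End smooth_maps.

(* A smooth atlas of dimension [d]; [atl_inv i] is the inverse of the chart
   [atl_map i], and both are relevant only on [atl_dom i] and its image.
   Two atlases of the same smooth structure give the same smooth functions, so
   maximality is not required. *)
Record smooth_atlas (R : realType) (d : nat) (X : topologicalType) := {
  atl_idx : Type ;
  atl_dom : atl_idx -> set X ;
  atl_map : atl_idx -> X -> 'rV[R]_d ;
  atl_inv : atl_idx -> 'rV[R]_d -> X ;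
  atl_cover : \bigcup_i atl_dom i = [set: X] ;
  atl_dom_open : forall i, open (atl_dom i) ;
  atl_img_open : forall i, open (atl_map i @` atl_dom i) ;
  atl_mapK : forall i, {in atl_dom i, cancel (atl_map i) (atl_inv i)} ;
  atl_map_continuous : forall i x, atl_dom i x ->
    {for x, continuous (atl_map i)} ;
  atl_inv_continuous : forall i x, atl_dom i x ->
    {for atl_map i x, continuous (atl_inv i)} ;
  atl_smooth : forall i j k,
    smooth_on (atl_map i @` (atl_dom i `&` atl_dom j))
      (fun y => atl_map j (atl_inv i y) 0 k)
}.

Record smooth_manifold (R : realType) (d : nat) (X : topologicalType) := {
  mfd_hausdorff : hausdorff_space X ;
  mfd_second_countable : @second_countable X ;
  mfd_atlas :> smooth_atlas R d X
}.

Section smooth_linear.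
Context {R : realType} {d : nat}.
Implicit Types (U : set 'rV[R]_d) (f g : 'rV[R]_d -> R) (s : seq 'I_d).

Lemma pderiv_lin U f g (a : R) : open U -> smooth_on U f -> smooth_on U g ->
  forall s x, U x ->
  pderiv s (a \*: f + g) x = a * pderiv s f x + pderiv s g x.
Proof.
move=> oU sf sg; elim=> [//|i s IH] x Ux /=.
have [_ /(_ i) df] := sf s x Ux; have [_ /(_ i) dg] := sg s x Ux.
rewrite (@near_eq_derive _ _ _ _ (a \*: pderiv s f + pderiv s g)).
  by rewrite deriveD ?deriveZ//; exact: derivableZ.
by apply: filterS (open_nbhs_nbhs (conj oU Ux)) => y /IH.
Qed.

Lemma smooth_on_lin U f g (a : R) : open U ->
  smooth_on U f -> smooth_on U g -> smooth_on U (a \*: f + g).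
Proof.
move=> oU sf sg s x Ux.
have [cf df] := sf s x Ux; have [cg dg] := sg s x Ux.
have nE : \near x, (a \*: pderiv s f + pderiv s g) x
    = pderiv s (a \*: f + g) x.
  apply: filterS (open_nbhs_nbhs (conj oU Ux)) => y Uy.
  by rewrite (pderiv_lin _ oU).
split=> [|i].
  rewrite /prop_for /continuous_at (pderiv_lin _ oU)//.
  apply: cvg_trans (near_eq_cvg nE) _.
  by apply: cvgD => //; apply: cvgZr.
apply: near_eq_derivable nE _.
by apply: derivableD => //; exact: derivableZ.
Qed.

Lemma pderiv_cst0 s : pderiv s (fun=> 0 : R) = fun=> 0.
Proof.
by elim: s => [//|i s IH]; apply/funext => x /=; rewrite IH derive_cst.
Qed.

Lemma smooth_on_cst0 U : smooth_on U (fun=> 0 : R).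
Proof.
by move=> s x _; rewrite pderiv_cst0; split=> [|i];
  [exact: cst_continuous|exact: derivable_cst].
Qed.

End smooth_linear.

Section euclidean_norm.
Context {R : realType} {p : nat}.
Implicit Types u v : 'rV[R]_p.

Lemma normr_le_norm2 v k : `|v 0 k| <= norm2 v.
Proof.
rewrite -sqrtr_sqr ler_wsqrtr// /sqnorm2 (bigD1 k)//= lerDl.
by apply: sumr_ge0 => i _; exact: sqr_ge0.
Qed.

Lemma norm2_le_sum v : norm2 v <= \sum_(k < p) `|v 0 k|.
Proof.
have s0 : 0 <= \sum_(k < p) `|v 0 k| by exact: sumr_ge0.
rewrite -[leRHS]ger0_norm// -sqrtr_sqr ler_wsqrtr// /sqnorm2.
rewrite expr2 mulr_suml ler_sum// => k _.
rewrite -real_normK ?num_real// expr2 ler_wpM2l// (bigD1 k)//= lerDl.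
exact: sumr_ge0.
Qed.

End euclidean_norm.

Section test_functions.
Context {R : realType} {d : nat} {X : topologicalType}.
Variables (M : smooth_atlas R d X) (p : nat).

Definition smooth_fun (g : X -> 'rV[R]_p) := forall (i : atl_idx M) k,
  smooth_on (atl_map i @` atl_dom i) (fun y => g (atl_inv i y) 0 k).

Definition bounded_fun2 (g : X -> 'rV[R]_p) :=
  exists C, forall x, norm2 (g x) <= C.

Definition test_pred : {pred X -> 'rV[R]_p} :=
  fun g => `[< smooth_fun g /\ bounded_fun2 g >].

Lemma test_submod_closed : submod_closed test_pred.
Proof.
split=> [|a f g /asboolP[sf [C fC]] /asboolP[sg [D gD]]]; apply/asboolP; split.
- move=> i k; rewrite (_ : (fun _ => _) = fun=> 0); first exact: smooth_on_cst0.
  by apply/funext => y; rewrite mxE.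
- exists 0 => x; apply: le_trans (norm2_le_sum _) _.
  by rewrite big1// => k _; rewrite mxE normr0.
- move=> i k; rewrite (_ : (fun _ => _) = a \*: (fun y => f (atl_inv i y) 0 k)
    + (fun y => g (atl_inv i y) 0 k)); last first.
    by apply/funext => y; rewrite !mxE.
  by apply: smooth_on_lin; [exact: atl_img_open|exact: sf|exact: sg].
- exists (\sum_(k < p) (`|a| * C + D)) => x.
  apply: le_trans (norm2_le_sum _) _; apply: ler_sum => k _.
  rewrite !mxE; apply: le_trans (ler_normD _ _) _.
  apply: lerD; last exact: le_trans (normr_le_norm2 _ _) (gD x).
  by rewrite normrM ler_wpM2l//; exact: le_trans (normr_le_norm2 _ _) (fC x).
Qed.

HB.instance Definition _ :=
  GRing.isSubmodClosed.Build R (X -> 'rV[R]_p) test_pred test_submod_closed.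

Record test := Test { test_val :> X -> 'rV[R]_p ; _ : test_val \in test_pred }.

HB.instance Definition _ := [isSub for test_val].
HB.instance Definition _ := [Choice of test by <:].
HB.instance Definition _ := [SubChoice_isSubLmodule of test by <:].

(* The mode of convergence in the test space: uniform boundedness on X and uniform convergence of all
   partial derivatives on the compact subsets of the charts (when X is compact
   the boundedness is automatic and this is convergence in C^oo).  *)
Definition test_cvg (g_ : nat -> test) (g : test) :=
  (exists C, forall n x, norm2 (g_ n x) <= C) /\
  forall (i : atl_idx M) (k : 'I_p) (s : seq 'I_d) (K : set 'rV[R]_d),
    compact K -> K `<=` atl_map i @` atl_dom i ->
    {uniform K, (fun n => pderiv s (fun y => g_ n (atl_inv i y) 0 k)) @ \oo -->
      pderiv s (fun y => g (atl_inv i y) 0 k)}.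

End test_functions.

Section distributions.
Context {R : realType} {d : nat} {X : topologicalType}.
Variables (M : smooth_atlas R d X) (p : nat).

(* The dual of the test space: the sequentially continuous linear functionals.
   This is its topological dual for the finest locally convex topology inducing
   the C^oo topology on the uniformly bounded sets, so that a functional
   is determined by its values on compactly supported functions. *)
Record dist := Dist {
  dist_fun :> {linear test M p -> R^o} ;
  dist_continuous : forall g_ g, test_cvg g_ g ->
    dist_fun (g_ n) @[n --> \oo] --> dist_fun g
}.

HB.instance Definition _ := gen_eqMixin dist.
HB.instance Definition _ := gen_choiceMixin dist.

Definition pairing (xi : dist) (g : test M p) : R := xi g.

Lemma delta_subproof (x : X) : exists i, atl_dom (s := M) i x.
Proof.
have : (\bigcup_i atl_dom (s := M) i) x by rewrite atl_cover.
by case=> i _ ?; exists i.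
Qed.

Section delta.
Variables (c : 'rV[R]_p) (x : X).

Definition delta_fun (g : test M p) : R^o := \sum_(k < p) c 0 k * g x 0 k.

Fact delta_fun_linear : linear delta_fun.
Proof.
move=> a f g; rewrite /delta_fun scaler_sumr -big_split/=.
apply: eq_bigr => k _; rewrite !mxE mulrDr; congr (_ + _).
by rewrite mulrCA.
Qed.

HB.instance Definition _ :=
  GRing.isLinear.Build R (test M p) R^o _ delta_fun delta_fun_linear.

Fact delta_fun_continuous g_ g : test_cvg g_ g ->
  delta_fun (g_ n) @[n --> \oo] --> delta_fun g.
Proof.
move=> [_ gg]; rewrite /delta_fun; apply: cvg_big => [|k _].
  exact: add_continuous.
apply: cvgMl_tmp.
have [i ix] := delta_subproof x.
have sK : [set atl_map i x] `<=` atl_map i @` atl_dom i.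
  by move=> _ ->; exists x.
have := @gg i k [::] _ (@compact_set1 _ _) sK.
have xE : atl_inv i (atl_map i x) = x by rewrite atl_mapK ?inE.
rewrite uniform_set1 /= xE; apply: cvg_trans; apply: near_eq_cvg.
by near=> n; rewrite /= xE.
Unshelve. all: by end_near. Qed.

Definition delta : dist := Dist delta_fun_continuous.

End delta.
End distributions.

Definition borel_type (T : ptopologicalType) := g_sigma_algebraType (@open T).

Section measure_on_distributions.
Context {R : realType} {d : nat} {X : ptopologicalType}.
Variables (M : smooth_atlas R d X) (p : nat).

HB.instance Definition _ :=
  isPointed.Build (dist M p) (delta M 0 point).

(* The weak-* topology, i.e., that of pointwise convergence on test functions *)
HB.instance Definition _ := Topological.copy (dist M p)
  (initial_topology
    (fun xi : dist M p => (pairing xi : {ptws test M p -> R}))).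

Definition fourier (mu : probability (borel_type (dist M p)) R)
    (g : test M p) : R[i] :=
  ((\int[mu]_xi cos (pairing xi g)) +i* (\int[mu]_xi sin (pairing xi g)))%C.

(* The sums of at most countably many [c^i \delta_{x_i}] with
   summable [|c^i|]; a finite sum is padded with null coefficients. *)
Definition atomic_dist : set (dist M p) :=
  [set xi | exists (c : nat -> 'rV[R]_p) (x : nat -> X),
     cvgn (series (fun i => norm2 (c i))) /\
     forall g : test M p,
       series (fun i => pairing (delta M (c i) (x i)) g) @ \oo -->
         pairing xi g].

End measure_on_distributions.

Arguments atomic_dist {R d X} M p _.

(* Main.v *)
(* The Fourier transform bounds [E (1 - cos (t xi(g)))] by
   [1/2 int ln (1 + t^2 |g|^2 / 4) dm].  Summing over [t = 16^q] with weights
   [4^-q], q in Z, gives [E sqrt |xi(g)| <= C int H(|g|) dm] for a function [H]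
   that is continuous and vanishes at 0.  Hence, if X is cut into finitely many
   cells with smooth approximate indicators [phi_i], the vectors [c_i] of the
   values of xi on [phi_i] satisfy [E sum_i w_i sqrt |c_i| <= C'], whatever the
   partition; here the weights [w_i] may come from an m-integrable function
   with relatively compact sublevel sets.  Along a sequence of finer and finer
   partitions, almost surely [xi(g)] is the limit of [sum_i c_i g(x_i)] for all
   g in a countable dense set of test functions, while the weighted sums stay
   bounded infinitely often.  For such a xi, sort the [c_i] in decreasing order,
   so that [|c_i| <= (V / i)^2], and take the limits of the i-th vectors and
   points along an ultrafilter: a point may escape to infinity only if its
   vector tends to 0.  By dominated convergence xi is the sum of the limiting
   atoms. *)

Require Import Defs.
From HB Require Import structures.
From mathcomp Require Import all_boot all_order all_algebra.
From mathcomp Require Import all_classical all_reals all_analysis.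
From mathcomp Require Import measurable_realfun complex.
From mathcomp Require Import ring lra.

Set Implicit Arguments.
Unset Strict Implicit.
Unset Printing Implicit Defensive.

Import Order.TTheory GRing.Theory Num.Theory.
Import numFieldNormedType.Exports.

Local Open Scope classical_set_scope.
Local Open Scope ring_scope.

(** * Calculus in several variables *)

(** The exponent 1/2 is what excludes a diffuse part. A bound on [sum |c_i|] alone would let the
    masses split into ever smaller pieces with a diffuse limit, whereas a bound on [sum sqrt |c_i|]
    makes the tails of the sorted sums small uniformly in the partition. At [t = 16^q] the weight
    4^-q is the one of homogeneity 1/2, and the series stands for the integral of
    [(1 - cos (t y)) t^(-3/2) dt].

    The moment bound does not see the partition because it is an integral over X: the cells are
    disjoint, and [H] of an indicator is [H 1] times that indicator. Indicators are not test
    functions, hence the smooth approximations and a limit under the integral.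

    Integrals that are merely bounded give, by Fatou, boundedness for infinitely many partitions
    only, and which ones depends on xi. The ultrafilter is therefore chosen after xi, inside that
    set of partitions, and yields all the limits at once.

    The exceptional null set must not depend on the test function. Hence the countable dense family,
    and error rates that depend on a test function only through its bound, so that they survive the
    passage to all test functions. *)

Lemma continuous_sum_at (R : realType) (T : topologicalType) (I : Type)
    (r : seq I) (P : pred I) (F : I -> T -> R) (x : T) :
  (forall i, P i -> {for x, continuous (F i)}) ->
  {for x, continuous (fun y => \sum_(i <- r | P i) F i y)}.
Proof.
move=> cF; rewrite /prop_for /continuous_at; apply: cvg_big => //.
exact: add_continuous.
Qed.

Section line.
Context {R : realType} {V : normedModType R}.
Implicit Types (f : V -> R) (a e : V).

Lemma is_derive_line f a e (t : R) : derivable f (a + t *: e) e ->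
  is_derive t 1 (fun s : R => f (a + s *: e)) ('D_e f (a + t *: e)).
Proof.
move=> df.
have E : (fun h : R => h^-1 *: (f (a + (h + t) *: e) - f (a + t *: e))) =
   (fun h : R => h^-1 *: (f (h *: e + (a + t *: e)) - f (a + t *: e))).
  by apply/funext => h; rewrite scalerDl addrCA.
have E' : (fun h : R => h^-1 *: (((fun s : R => f (a +
  s *: e)) \o shift t) (h *: (1 : R)) -
   f (a + t *: e))) =
   (fun h : R => h^-1 *: (f (h *: e + (a + t *: e)) - f (a + t *: e))).
  by rewrite -E; apply/funext => h /=; rewrite [h *: 1]mulr1.
by split; rewrite /derivable /derive E'.
Qed.

Lemma derive_along_line (W : normedModType R) (F : V -> W) a e :
  'D_e F a = 'D_(1 : R) (fun s : R => F (s *: e + a)) 0.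
Proof.
rewrite /derive; set F1 := fun h => _; set F2 := fun h => _.
suff -> : F1 = F2 by [].
by apply/funext => s; rewrite /F1 /F2/= addr0 [s%:A]mulr1 scale0r add0r.
Qed.

Lemma MVT_line f a e (v : R) :
  (forall t, `|t| <= `|v| -> derivable f (a + t *: e) e) ->
  exists2 t, `|t| <= `|v| & f (a + v *: e) - f a = v * 'D_e f (a + t *: e).
Proof.
move=> df.
pose g (s : R) := f (a + s *: e).
have dg (t : R) : `|t| <= `|v| -> is_derive t 1 g ('D_e f (a + t *: e)).
  by move=> tv; apply: is_derive_line; exact: df.
have cg (t : R) : `|t| <= `|v| -> {for t, continuous g}.
  move=> /dg[gt _]; apply: differentiable_continuous.
  exact/derivable1_diffP.
have [v0|v0] := leP 0 v.
  have [||t] := @MVT_segment R g (fun t => 'D_e f (a + t *: e)) 0 v v0.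
  - move=> t; rewrite in_itv/= => /andP[t0 tv]; apply: dg.
    by rewrite !ger0_norm// ltW.
  - apply: continuous_in_subspaceT => t; rewrite inE/= in_itv/= => /andP[t0 tv].
    by apply: cg; rewrite !ger0_norm.
  rewrite in_itv/= => /andP[t0 tv]; rewrite /g scale0r addr0 subr0 => ->.
  by exists t; [rewrite !ger0_norm|rewrite mulrC].
have [||t] := @MVT_segment R g (fun t => 'D_e f (a + t *: e)) v 0 (ltW v0).
- move=> t; rewrite in_itv/= => /andP[t0 tv]; apply: dg.
  by rewrite (ltr0_norm v0) ltr0_norm// lerN2 ltW.
- apply: continuous_in_subspaceT => t; rewrite inE/= in_itv/= => /andP[t0 tv].
  by apply: cg; rewrite (ltr0_norm v0) ler0_norm// lerN2.
rewrite in_itv/= => /andP[t0 tv]; rewrite /g scale0r addr0 sub0r => E.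
exists t; first by rewrite (ltr0_norm v0) ler0_norm// lerN2.
by rewrite -opprB E mulrN opprK mulrC.
Qed.

End line.

Section differentiable_partial.
Context {R : realType} {d : nat}.
Implicit Types (f : 'rV[R]_d -> R) (x v : 'rV[R]_d).

Local Notation basis i := (delta_mx 0 i : 'rV[R]_d).

Definition dpartial f x v : R := \sum_(i < d) v 0 i * 'D_(basis i) f x.

Fact dpartial_linear f x : linear (dpartial f x : 'rV[R]_d -> R^o).
Proof.
move=> a u v; rewrite /dpartial scaler_sumr -big_split/=.
by apply: eq_bigr => i _; rewrite !mxE mulrDl [in RHS]/GRing.scale/= mulrA.
Qed.

HB.instance Definition _ f x :=
  GRing.isLinear.Build R 'rV[R]_d R^o _ (dpartial f x) (dpartial_linear f x).

Lemma normr_mx_entry v i : `|v 0 i| <= `|v|.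
Proof.
rewrite [leRHS]/Num.Def.normr/= mx_normrE.
exact: (le_bigmax _ (fun i : 'I_1 * 'I_d => `|v i.1 i.2|) (0, i)).
Qed.

Lemma normr_mx_le v (e : R) : 0 <= e -> (forall i, `|v 0 i| <= e) -> `|v| <= e.
Proof.
move=> e0 ve; rewrite [leLHS]/Num.Def.normr/= mx_normrE.
by apply: bigmax_le => // -[i j] _ /=; rewrite ord1.
Qed.

Lemma continuous_dpartial f x : continuous (dpartial f x).
Proof.
move=> v; apply: continuous_sum_at => i _.
by apply: continuousM; [exact: coord_continuous|exact: cst_continuous].
Qed.

(** Going from [x] to [x + v] one coordinate at a time, each increment is, by the mean value
    theorem, a partial derivative at a nearby point times a coordinate of [v]; continuity of the
    partial derivatives then compares it with the one at [x]. *)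
Lemma differentiable_partial f x :
  (\forall y \near x, forall i, derivable f y (basis i)) ->
  (forall i, {for x, continuous ('D_(basis i) f)}) ->
  is_diff x f (dpartial f x).
Proof.
move=> df cf.
suff H : (f : 'rV[R]_d -> R^o) \o shift x =
    (cst (f x : R^o) : 'rV[R]_d -> R^o) + (dpartial f x : 'rV[R]_d -> R^o)
    +o_ (0 : 'rV[R]_d) id.
  have dE := diff_unique (@continuous_dpartial f x) H.
  split=> //; apply/diff_locallyP; split; last by rewrite dE.
  by rewrite dE; exact: continuous_dpartial.
apply/eqaddoP => _/posnumP[e].
(* There are [d] increments, each with error at most [e' * |v|]; the successor covers [d = 0]. *)
pose e' := e%:num / d.+1%:R.
have e'0 : 0 < e' by rewrite divr_gt0.
have : \forall y \near x, forall i,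
  `|'D_(basis i) f y - 'D_(basis i) f x| <= e'.
  have FF := nbhs_filter x.
  apply: (@filter_forall _ _
    (fun i y => `|'D_(basis i) f y - 'D_(basis i) f x| <= e') _ FF) => i;
      have /cvgrPdist_le/(_ _ e'0) := cf i.
  by apply: filterS => y; rewrite distrC.
move=> cf'; have := @filterI _ _ (nbhs_filter x) _ _ df cf'.
move=> /nbhs_ballP[r/= r0 xr].
have Hr y : `|y - x| < r -> (forall i, derivable f y (basis i)) /\
    forall i, `|'D_(basis i) f y - 'D_(basis i) f x| <= e'.
  by move=> yx; apply: xr; rewrite -ball_normE/= distrC.
apply/nbhs_ballP; exists r => //= v; rewrite -ball_normE/= sub0r normrN => vr.
(* [tr k] keeps the first [k] coordinates of [v]: the corners of the path from 0 to [v]. *)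
pose tr (k : nat) : 'rV[R]_d := \row_j (if (j < k)%N then v 0 j else 0).
have trd : tr d = v by apply/rowP => j; rewrite mxE ltn_ord.
have tr0 : tr 0%N = 0 by apply/rowP => j; rewrite !mxE.
have trS (k : 'I_d) : tr k.+1 = tr k + v 0 k *: basis k.
  apply/rowP => j; rewrite !mxE eqxx/= ltnS leq_eqVlt -val_eqE/=.
  case: eqVneq => [/= /val_inj ->|/=]; first by rewrite ltnn mulr1 add0r.
  by rewrite mulr0 addr0.
have step (k : 'I_d) : `|f (tr k.+1 + x) - f (tr k +
  x) - v 0 k * 'D_(basis k) f x|
    <= e' * `|v|.
  have near_seg t : `|t| <= `|v 0 k| -> `|(x + tr k + t *: basis k) - x| < r.
    move=> tv; apply: le_lt_trans vr; rewrite addrAC (addrAC x) subrr add0r.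
    apply: normr_mx_le => // j; rewrite !mxE eqxx/=.
    have [->|jk] := eqVneq j k.
      by rewrite ltnn add0r mulr1; apply: le_trans tv _; exact: normr_mx_entry.
    rewrite mulr0 addr0; case: ifP => _; last by rewrite normr0.
    exact: normr_mx_entry.
  have [t tv E] := @MVT_line _ _ f (x + tr k) (basis k) (v 0 k)
    (fun t tv => (Hr _ (near_seg t tv)).1 k).
  rewrite trS (addrC _ x) addrA (addrC _ x) E -mulrBr normrM mulrC.
  apply: ler_pM => //; last exact: normr_mx_entry.
  exact: (Hr _ (near_seg t tv)).2.
have tele : f (v + x) - f x = \sum_(k < d) (f (tr k.+1 + x) - f (tr k + x)).
  rewrite -(big_mkord xpredT (fun k => f (tr k.+1 + x) - f (tr k + x))).
  by rewrite telescope_sumr// trd tr0 add0r.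
have -> : (f \o shift x - (cst (f x) + dpartial f x)) v =
  \sum_(k < d) (f (tr k.+1 + x) - f (tr k + x) - v 0 k * 'D_(basis k) f x).
  rewrite sumrB -tele -[LHS]/(f (v + x) - (f x + dpartial f x v)) opprD addrA.
  by [].
apply: le_trans (ler_norm_sum _ _ _) _.
apply: le_trans (ler_sum _ (fun k _ => step k)) _.
rewrite sumr_const card_ord -mulr_natl mulrA ler_wpM2r// /e'.
by rewrite mulrCA ler_piMr// ler_pdivrMr// mul1r ler_nat.
Qed.

(** Since [tau] is only known to be derivable in the direction [v], the chain rule is applied to its
    restriction to the line through [y], where derivability in one variable gives
    differentiability. *)
Lemma is_derive_comp_partial (h : 'rV[R]_d -> R) (V : normedModType R)
    (tau : V -> 'rV[R]_d) (y v : V) :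
  (\forall z \near tau y, forall i, derivable h z (basis i)) ->
  (forall i, {for tau y, continuous ('D_(basis i) h)}) ->
  (forall k, derivable (fun w => tau w 0 k) y v) ->
  is_derive y v (h \o tau)
    (\sum_(k < d) 'D_v (fun w => tau w 0 k) y * 'D_(basis k) h (tau y)).
Proof.
move=> dh ch dtau.
have hdiff := differentiable_partial dh ch.
pose g (s : R) := tau (s *: v + y).
have dg : derivable g 0 1.
  apply/derivable_mxP => i k; rewrite ord1.
  exact: (derivable1P _ _ _).1 (dtau k).
have gdiff : differentiable g 0 by exact/derivable1_diffP.
have g0 : g 0 = tau y by rewrite /g scale0r add0r.
have hdg : is_diff (g 0) h (dpartial h (tau y)) by rewrite g0.
have hgdiff : differentiable (h \o g) 0.
  by apply: differentiable_comp => //; exact: ex_diff.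
have dhg : derivable (h \o g) 0 1 by exact: diff_derivable.
split; first exact: ((derivable1P (h \o tau) y v).2 dhg).
have E : 'd h (g 0) = dpartial h (tau y) :> (_ -> _) by exact: diff_val.
rewrite derive_along_line -[LHS]/('D_1 (h \o g) 0) deriveE// diff_comp//=.
rewrite E -deriveE// /dpartial; apply: eq_bigr => k _; congr (_ * _).
by rewrite derive_mx// mxE derive_along_line.
Qed.

End differentiable_partial.

Lemma In_cat (T : Type) (x : T) (s1 s2 : seq T) :
  List.In x (s1 ++ s2) -> List.In x s1 \/ List.In x s2.
Proof.
elim: s1 => [|y s1 IH] /=; first by right.
by case=> [->|/IH[]]; [left; left|left; right|right].
Qed.

Lemma continuous_rV (R : realType) (d : nat) (T : topologicalType)
    (tau : T -> 'rV[R]_d) (y : T) :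
  (forall k, {for y, continuous (fun w => tau w 0 k)}) ->
  {for y, continuous tau}.
Proof.
move=> ctau; apply/cvgrPdist_le => e e0.
have : \forall w \near y, forall k, `|tau y 0 k - tau w 0 k| <= e.
  apply: filter_forall => k; have /cvgrPdist_le/(_ _ e0) := ctau k.
  exact.
apply: filterS => w tauw; apply: normr_mx_le; first exact: ltW.
by move=> k; rewrite !mxE.
Qed.

Lemma near_mono (T : topologicalType) (x : T) (P Q : T -> Prop) :
  (\forall y \near x, P y) -> (forall y, P y -> Q y) -> \forall y \near x, Q y.
Proof. by move=> xP PQ; exact: filterS xP. Qed.

Lemma near_interior (T : topologicalType) (x : T) (P Q : T -> Prop) :
  (\forall y \near x, P y) -> (forall y, (\forall z \near y, P z) -> Q y) ->
  \forall y \near x, Q y.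
Proof. by move=> /nbhs_interior xP PQ; apply: filterS xP => y /PQ. Qed.

(** * Sums, products and composites of smooth functions *)

Section smooth_algebra.
Context {R : realType} {d : nat}.
Implicit Types (U V : set 'rV[R]_d) (f g h : 'rV[R]_d -> R) (s : seq 'I_d).

Local Notation basis i := (delta_mx 0 i : 'rV[R]_d).

(** The recursion takes the innermost derivative first, whereas [pderiv] puts the head of its list
    outermost. This is the form in which the Leibniz rule allows an induction on [m] over all
    functions. *)
Fixpoint Ck (m : nat) U f : Prop :=
  (forall x, U x -> {for x, continuous f}) /\
  if m is m'.+1 then
    forall i, (forall x, U x -> derivable f x (basis i)) /\
      Ck m' U ('D_(basis i) f)
  else True.

Lemma pderiv_rcons s i f : pderiv (rcons s i) f = pderiv s ('D_(basis i) f).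
Proof. by elim: s => //= j s ->. Qed.

Lemma smooth_onP U f : smooth_on U f <-> forall m, Ck m U f.
Proof.
split=> [+ m|].
  elim: m f => [|m IH] f sf; (split; first by move=> x Ux;
    have [] := sf [::] x Ux) => //.
  move=> i; split; first by move=> x Ux; have [_ /(_ i)] := sf [::] x Ux.
  by apply: IH => s x Ux; rewrite -pderiv_rcons; exact: sf.
move=> cf s; elim/last_ind: s f cf => [f cf x Ux|s i IH f cf].
  have [cfx df] := cf 1%N; split; first exact: cfx.
  by move=> i; have [+ _] := df i; exact.
by rewrite pderiv_rcons; apply: IH => m; have [_ /(_ i)[]] := cf m.+1.
Qed.

Lemma smooth_on_deriv U f i : smooth_on U f -> smooth_on U ('D_(basis i) f).
Proof. by move=> sf s x Ux; rewrite -pderiv_rcons; exact: sf. Qed.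

Lemma near_open U x (P : 'rV[R]_d -> Prop) : open U -> U x ->
  (forall y, U y -> P y) -> \forall y \near x, P y.
Proof. by move=> oU Ux UP; apply: filterS (open_nbhs_nbhs (conj oU Ux)). Qed.

Lemma eq_continuous_at (T : topologicalType) (F G : T -> R) (x : T) :
  (\forall y \near x, F y = G y) -> {for x, continuous F} ->
  {for x, continuous G}.
Proof.
move=> fg; rewrite /prop_for /continuous_at -(nbhs_singleton fg).
by apply: cvg_trans; apply: near_eq_cvg; apply: filterS fg => y ->.
Qed.

Lemma eq_pderiv f g s (x : 'rV[R]_d) : (\forall y \near x, f y = g y) ->
  \forall y \near x, pderiv s f y = pderiv s g y.
Proof.
move=> fg; elim: s => [//|i s IH] /=.
apply: near_interior IH _ => y yfg; exact: near_eq_derive.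
Qed.

(** The derivatives at [x] depend only on the germ there. Smoothness can thus be checked point by
    point after replacing the function near the point, which is how the bump on the manifold is
    glued. *)
Lemma eq_smooth_at f g (x : 'rV[R]_d) : (\forall y \near x, f y = g y) ->
  smooth_on [set x] f -> smooth_on [set x] g.
Proof.
move=> fg sf s _ ->; have [cf df] := sf s x erefl.
have fgs := eq_pderiv s fg; split; first exact: eq_continuous_at fgs cf.
by move=> i; apply: near_eq_derivable fgs (df i).
Qed.

Lemma smooth_on_at U f : smooth_on U f <-> forall x, U x -> smooth_on [set x] f.
Proof.
by split=> [sf x Ux s _ ->|sf s x Ux]; [exact: sf|exact: (sf x Ux s x)].
Qed.

Lemma Ck_eq m U f g : open U -> {in U, f =1 g} -> Ck m U f -> Ck m U g.
Proof.
move=> oU; elim: m f g => [|m IH] f g fg [cf df].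
all: have fgn x (Ux : U x) : \forall y \near x, f y = g y
  by apply: (near_open oU Ux) => y Uy; apply: fg; rewrite inE.
all: split; first by move=> x Ux; apply: eq_continuous_at (fgn x Ux) (cf x Ux).
- by [].
move=> i; have [dfi Cf] := df i; split.
  by move=> x Ux; apply: near_eq_derivable (fgn x Ux) (dfi x Ux).
apply: IH Cf => x; rewrite inE => Ux.
exact: near_eq_derive (fgn x Ux).
Qed.

Lemma CkS m U f : Ck m.+1 U f -> Ck m U f.
Proof.
elim: m f => [|m IH] f [cf df]; split=> // i.
by have [dfi Cf] := df i; split=> //; exact: IH.
Qed.

Lemma CkD m U f g : open U -> Ck m U f -> Ck m U g -> Ck m U (f \+ g).
Proof.
move=> oU; elim: m f g => [|m IH] f g [cf df] [cg dg].
all: split; first by move=> x Ux; exact: (continuousD (cf x Ux) (cg x Ux)).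
- by [].
move=> i; have [dfi Cf] := df i; have [dgi Cg] := dg i; split.
  by move=> x Ux; apply: derivableD; [exact: dfi|exact: dgi].
apply: Ck_eq (IH _ _ Cf Cg) => // x; rewrite inE => Ux /=.
by rewrite deriveD//; [exact: dfi|exact: dgi].
Qed.

Lemma CkM m U f g : open U -> Ck m U f -> Ck m U g -> Ck m U (f \* g).
Proof.
move=> oU; elim: m f g => [|m IH] f g Cf0 Cg0.
all: have [cf df] := Cf0; have [cg dg] := Cg0.
all: split; first by move=> x Ux; exact: (continuousM (cf x Ux) (cg x Ux)).
- by [].
move=> i; have [dfi Cf] := df i; have [dgi Cg] := dg i; split.
  by move=> x Ux; apply: derivableM; [exact: dfi|exact: dgi].
apply: Ck_eq (CkD oU (IH _ _ (CkS Cf0) Cg) (IH _ _ (CkS Cg0) Cf)) => //.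
move=> x; rewrite inE => Ux /=.
by rewrite deriveM//; [exact: dfi|exact: dgi].
Qed.

Lemma smooth_onD U f g : open U -> smooth_on U f -> smooth_on U g ->
  smooth_on U (f \+ g).
Proof.
move=> oU /smooth_onP sf /smooth_onP sg; apply/smooth_onP => m.
exact: CkD.
Qed.

Lemma smooth_onM U f g : open U -> smooth_on U f -> smooth_on U g ->
  smooth_on U (f \* g).
Proof.
move=> oU /smooth_onP sf /smooth_onP sg; apply/smooth_onP => m.
exact: CkM.
Qed.

Lemma smooth_on_cst U (c : R) : smooth_on U (fun=> c).
Proof.
move=> s x Ux; case: s => [|i s].
  by split=> [|i]; [exact: cst_continuous|exact: derivable_cst].
have -> : pderiv (i :: s) (fun=> c) = cst 0.
  elim: s i => [|j s IH] i; apply/funext => y; first exact: derive_cst.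
  by rewrite -[LHS]/('D_(basis i) (pderiv (j :: s) (fun=> c)) y) IH derive_cst.
by split=> [|j]; [exact: cst_continuous|exact: derivable_cst].
Qed.

Lemma smooth_on_sum (I : Type) (r : seq I) (P : pred I) U (F : I -> 'rV[R]_d ->
  R) :
  open U -> (forall i, P i -> smooth_on U (F i)) ->
  smooth_on U (fun x => \sum_(i <- r | P i) F i x).
Proof.
move=> oU sF; elim: r => [|i r IH].
  rewrite (_ : (fun _ => _) = fun=> 0); first exact: smooth_on_cst.
  by apply/funext => x; rewrite big_nil.
rewrite (_ : (fun _ => _) =
  if P i then F i \+ (fun x => \sum_(i <- r | P i) F i x)
  else (fun x => \sum_(i <- r | P i) F i x)).
  case: ifPn => [Pi|_]; last exact: IH.
  by apply: smooth_onD; [exact: oU|exact: sF|exact: IH].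
by apply/funext => x; rewrite big_cons; case: ifP.
Qed.

Lemma smooth_on_coord U i : open U -> smooth_on U (fun x => x 0 i).
Proof.
move=> oU; apply/smooth_onP => -[|m]; split=> //.
- by move=> x _; exact: coord_continuous.
- by move=> x _; exact: coord_continuous.
have dc j (x : 'rV[R]_d) :
    is_derive x (basis j) (fun y : 'rV[R]_d => y 0 i) ((i == j)%:R).
  have /derivable_mxP/(_ 0 i) dx := @derivable_id _ _ x (basis j); split=> //.
  have := derive_mx (@derivable_id _ _ x (basis j)).
  by rewrite derive_id => /matrixP/(_ 0 i); rewrite !mxE eqxx/= => ->.
move=> j; split; first by move=> x _; exact: ex_derive.
rewrite (_ : 'D_(basis j) (fun x : 'rV[R]_d => x 0 i) = cst ((i == j)%:R : R));
  last first.
  by apply/funext => x; exact: derive_val.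
by have /smooth_onP := @smooth_on_cst U (i == j)%:R.
Qed.

(* Gives at once the smoothness of composites and the transfer of the
   convergence of all derivatives from one chart to another. *)
Lemma pderiv_comp U V (tau : 'rV[R]_d -> 'rV[R]_d) s : open U -> open V ->
  (forall y, V y -> U (tau y)) ->
  (forall k, smooth_on V (fun y => tau y 0 k)) ->
  exists2 L : seq (('rV[R]_d -> R) * seq 'I_d),
    forall us, List.In us L -> smooth_on V us.1 &
    forall h, smooth_on U h -> forall y, V y ->
      pderiv s (h \o tau) y = \sum_(us <- L) us.1 y * pderiv us.2 h (tau y).
Proof.
move=> oU oV UV stau; elim: s => [|i s [L sL EL]].
  exists [:: (cst 1, [::])]; first by move=> us [<-|[]]; exact: smooth_on_cst.
  by move=> h sh y Vy; rewrite big_seq1/= mul1r.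
(* The derivative of one term [u * (D^s h o tau)]: either [u] is differentiated, or the chain rule
   adds a derivative in direction [k], with coefficient [u * D_i tau_k]. *)
pose L' (us : ('rV[R]_d -> R) * seq 'I_d) : seq (('rV[R]_d -> R) * seq 'I_d) :=
  ('D_(basis i) us.1, us.2) ::
  [seq (us.1 \* 'D_(basis i) (fun y => tau y 0 k), k :: us.2) | k <- enum 'I_d].
exists (flatten [seq L' us | us <- L]).
  elim: L sL {EL} => [|us L IH] sL us'; first by case.
  move=> /(@In_cat _ us' (L' us))[[<-|]|].
  - by apply: smooth_on_deriv; apply: sL; left.
  - elim: (enum 'I_d) => [//|k ks IHk] /= [<-|//].
    apply: smooth_onM => //; first by apply: sL; left.
    exact: smooth_on_deriv.
  - by move=> us'L; apply: IH us'L => ? ?; apply: sL; right.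
move=> h sh y Vy /=.
rewrite (@near_eq_derive _ _ _ _
  (fun y => \sum_(us <- L) us.1 y * pderiv us.2 h (tau y))); last first.
  by apply: (near_open oV Vy) => z /(EL h sh).
have Uy := UV y Vy.
have H : is_derive y (basis i)
    (fun y => \sum_(us <- L) us.1 y * pderiv us.2 h (tau y))
    (\sum_(us <- flatten [seq L' us | us <- L]) us.1 y * pderiv us.2 h (tau y)).
  elim: L sL {EL} => [|us L IH] sL.
    rewrite /= big_nil (_ : (fun _ => _) = cst 0); first exact: is_derive_cst.
    by apply/funext => z; rewrite big_nil.
  rewrite (_ : (fun _ => _) = (us.1 \* (pderiv us.2 h \o tau)) +
    fun z => \sum_(us <- L) us.1 z * pderiv us.2 h (tau z)); last first.
    by apply/funext => z; rewrite big_cons.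
  rewrite /= big_cons big_cat/= addrA; apply: is_deriveD; last first.
    by apply: IH => us' ?; apply: sL; right.
  have [_ /(_ i) du] := sL us (or_introl erefl) [::] y Vy.
  have dc : is_derive y (basis i) (pderiv us.2 h \o tau)
      (\sum_(k < d) 'D_(basis i) (fun w => tau w 0 k) y *
        'D_(basis k) (pderiv us.2 h) (tau y)).
    apply: is_derive_comp_partial.
    - by apply: (near_open oU Uy) => z Uz k; have [_] := sh us.2 z Uz.
    - by move=> k; exact: (sh (k :: us.2) _ Uy).1.
    - by move=> k; exact: (stau k [::] y Vy).2.
  rewrite addrC big_map big_enum/=.
  case: dc => dc1 dc2; split; first exact: (derivableM du dc1).
  rewrite (deriveM du dc1) dc2 /= scaler_sumr; congr (_ + _).
    by apply: eq_bigr => k _; rewrite -[RHS]mulrA.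
  by rewrite -[LHS]/(_ * _) mulrC.
exact: derive_val.
Qed.

Lemma smooth_on_comp U V (tau : 'rV[R]_d -> 'rV[R]_d) h : open U -> open V ->
  (forall y, V y -> U (tau y)) ->
  (forall k, smooth_on V (fun y => tau y 0 k)) ->
  smooth_on U h -> smooth_on V (h \o tau).
Proof.
move=> oU oV UV stau sh s y Vy.
have [L sL EL] := pderiv_comp s oU oV UV stau.
have E : \forall z \near y, \sum_(us <- L) us.1 z * pderiv us.2 h (tau z) =
    pderiv s (h \o tau) z.
  by apply: (near_open oV Vy) => z Vz; rewrite (EL h sh).
have Uy := UV y Vy.
have ctau : {for y, continuous tau}.
  by apply: continuous_rV => k; have [] := stau k [::] y Vy.
suff [H1 H2] : {for y, continuous (fun z => \sum_(us <- L) us.1 z * pderiv us.2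
  h (tau z))} /\
    forall i, derivable (fun z => \sum_(us <- L) us.1 z * pderiv us.2 h (tau z))
      y (basis i).
  split; first exact: eq_continuous_at E H1.
  by move=> i; apply: near_eq_derivable E (H2 i).
elim: L sL {EL E} => [|us L IH] sL.
  rewrite (_ : (fun _ => _) = cst 0); last by apply/funext => z;
    rewrite big_nil.
  by split=> [|i]; [exact: cst_continuous|exact: derivable_cst].
rewrite (_ : (fun _ => _) = (us.1 \* (pderiv us.2 h \o tau)) +
  fun z => \sum_(us <- L) us.1 z * pderiv us.2 h (tau z)); last first.
  by apply/funext => z; rewrite big_cons.
have [|H1 H2] := IH; first by move=> us' ?; apply: sL; right.
have [cu du] := sL us (or_introl erefl) [::] y Vy.
have [ch dh] := sh us.2 _ Uy.
split.
  apply: (continuousD (f := us.1 \* (pderiv us.2 h \o tau))); last exact: H1.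
  by apply: (continuousM cu); exact: continuous_comp.
move=> i; apply: derivableD; last exact: H2.
apply: derivableM; first exact: du.
have [|||dht _] := @is_derive_comp_partial _ _ (pderiv us.2 h) _ tau y (basis
  i).
- apply: (near_open oU Uy) => z Uz k; exact: (sh us.2 z Uz).2.
- by move=> k; exact: (sh (k :: us.2) _ Uy).1.
- by move=> k; exact: (stau k [::] y Vy).2.
- exact: dht.
Qed.

End smooth_algebra.

(** * Flat functions and bumps *)

Section flat_function.
Context {R : realType}.
Implicit Types (t : R) (n : nat).

(** The classical [t^-n e^(-1/t)], extended by 0. The index [n] closes the family under derivation,
    up to linear combinations, so smoothness is an induction over all [n] at once. *)
Definition flat n t : R := if 0 < t then t^-1 ^+ n * expR (- t^-1) else 0.

Lemma flat_le0 n t : t <= 0 -> flat n t = 0.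
Proof. by rewrite /flat leNgt => /negbTE ->. Qed.

Lemma flat_gt0 n t : 0 < t -> 0 < flat n t.
Proof. by move=> t0; rewrite /flat t0 mulr_gt0 ?exprn_gt0 ?invr_gt0 ?expR_gt0.
  Qed.

Lemma flat_ge0 n t : 0 <= flat n t.
Proof.
by have [t0|t0] := ltP 0 t; [exact/ltW/flat_gt0|rewrite flat_le0].
Qed.

Lemma flat0_le1 t : flat 0 t <= 1.
Proof.
rewrite /flat; case: ifPn => // t0.
by rewrite expr0 mul1r expR_le1 oppr_le0 invr_ge0 ltW.
Qed.

(** With [s = 1/t], one term of the exponential series gives [e^s >= s^(n+1) / (n+1)!], and the
    claim is this inequality divided by [s e^s], up to the factorial. *)
Lemma flat_le n t : 0 < t -> flat n t <= n.+1`!%:R * t.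
Proof.
move=> t0; rewrite /flat t0 expRN ler_pdivrMr ?expR_gt0//.
have := @expR_ge1Dxn R t^-1 n; rewrite invr_ge0 => /(_ (ltW t0)) H.
have {}H : t^-1 ^+ n.+1 / n.+1`!%:R <= expR t^-1.
  by apply: le_trans H; rewrite lerDr.
rewrite ler_pdivrMr ?ltr0n ?fact_gt0// in H.
have -> : t^-1 ^+ n = t * t^-1 ^+ n.+1
  by rewrite exprS mulrA divff ?mul1r// gt_eqF.
rewrite (_ : _ * t * _ = t * (expR t^-1 * n.+1`!%:R)) ?ler_pM2l//.
by rewrite mulrAC mulrC; congr (_ * _); rewrite mulrC.
Qed.

Lemma flatS n t : t^-1 * flat n t = flat n.+1 t.
Proof. by rewrite /flat; case: ifP => _; rewrite ?mulr0// exprS mulrA. Qed.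

Lemma flat_cvg0 n : flat n t @[t --> 0] --> (0 : R).
Proof.
apply/cvgrPdist_le => e e0.
pose C : R := n.+1`!%:R; have C0 : 0 < C by rewrite ltr0n fact_gt0.
near=> t; rewrite sub0r normrN ger0_norm ?flat_ge0//.
have [t0|t0] := ltP 0 t; last by rewrite flat_le0// ltW.
apply: le_trans (flat_le n t0) _; rewrite mulrC -ler_pdivlMr//.
near: t; apply: nbhs0_ltW; rewrite divr_gt0.
Unshelve. all: by end_near. Qed.

Lemma is_derive_flat n t :
  is_derive t 1 (flat n) (flat n.+2 t - n%:R * flat n.+1 t).
Proof.
have [t0|t0|->] := ltgtP t 0.
- rewrite !flat_le0 ?ltW// mulr0 subr0.
  apply: (@near_eq_is_derive _ _ _ (cst 0)).
  by near=> s; rewrite flat_le0// ltW//; near: s; exact: lt_nbhsl.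
- have V : is_derive t 1 (fun s : R => s^-1) (- t ^- 2).
    rewrite (_ : - t ^- 2 = - t ^- 2 *: (1 : R)); last by rewrite [RHS]mulr1.
    by apply: is_deriveV; rewrite gt_eqF.
  have E : is_derive t 1 (fun s : R => expR (- s^-1)) (t ^- 2 * expR (- t^-1)).
    rewrite mulrC; apply: (is_derive1_comp (f := expR) (g :=
      fun s : R => - s^-1)).
    by rewrite -[t ^- 2]opprK; exact: is_deriveN.
  have P0 : is_derive t^-1 1 (fun s : R => s ^+ n) (n%:R * t^-1 ^+ n.-1).
    split; first exact: exprn_derivable.
    by rewrite exp_derive [_%:A]mulr1.
  have P : is_derive t 1 (fun s : R => s^-1 ^+ n) (n%:R * t^-1 ^+ n.-1 * - t ^-
    2).
    exact: (is_derive1_comp (f := fun s : R => s ^+ n) (g :=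
      fun s : R => s^-1)).
  apply: (@near_eq_is_derive _ _ _
    ((fun s : R => s^-1 ^+ n) * (fun s : R => expR (- s^-1)))).
    by near=> s; rewrite /flat ifT//; near: s; exact: lt_nbhsr.
  apply: is_derive_eq; rewrite /flat t0 -![_ *: _]/(_ * _) -exprVn.
  case: n {P0 P} => [|n]; first
    by rewrite !expr0 !mul0r !mulr0 addr0 subr0 !mul1r.
  by rewrite /= !exprS; ring.
- rewrite !flat_le0// mulr0 subr0.
  suff H : h^-1 *: ((flat n \o shift 0) (h *: (1 : R)) - flat n 0) @[h --> 0^']
    --> (0 : R).
    by split; [apply/cvg_ex; exists 0|exact/cvg_lim].
  (* At 0 the difference quotient is again a flat function, [h^-1 flat n h = flat (n+1) h], and it
     tends to 0. *)
  rewrite (_ : (fun h => _) = flat n.+1).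
    by apply: cvg_trans (@flat_cvg0 n.+1); apply: cvg_app; exact: cvg_within.
  apply/funext => h /=; rewrite (flat_le0 n (lexx 0)) subr0 addr0.
  by rewrite -flatS [h *: (1 : R)]mulr1.
Unshelve. all: by end_near. Qed.

Lemma continuous_flat n : continuous (flat n).
Proof.
move=> t; apply: differentiable_continuous; apply/derivable1_diffP.
by have [] := is_derive_flat n t.
Qed.

Lemma is_derive_comp_real (V : normedModType R) (F : R -> R) (q : V -> R)
    (y v : V) (dF dq : R) :
  is_derive (q y) 1 F dF -> is_derive y v q dq ->
  is_derive y v (F \o q) (dF * dq).
Proof.
move=> FD qD.
have q1 : is_derive (0 : R) 1 (fun s : R => q (s *: v + y)) dq.
  split; first by case: qD => + _; move/derivable1P.
  by rewrite -derive_along_line; exact: derive_val.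
have F1 : is_derive ((fun s : R => q (s *: v + y)) 0) 1 F dF.
  by rewrite /= scale0r add0r.
have [H1 H2] := is_derive1_comp F1 q1.
split; first exact: ((derivable1P (F \o q) y v).2 H1).
by rewrite derive_along_line.
Qed.

Lemma smooth_on_flat (d : nat) (U : set 'rV[R]_d) (q : 'rV[R]_d -> R) n :
  open U -> smooth_on U q -> smooth_on U (flat n \o q).
Proof.
move=> oU sq; apply/smooth_onP => m.
elim: m n => [|m IH] n.
all: split; first by move=> x Ux; apply: continuous_comp;
  [exact: (sq [::] x Ux).1|exact: continuous_flat].
- by [].
have D i x (Ux : U x) := is_derive_comp_real (is_derive_flat n (q x))
  (derivableP ((sq [::] x Ux).2 i)).
move=> i; split; first by move=> x Ux; have [] := D i x Ux.
have sC c : Ck m U (fun=> c) by have /smooth_onP := @smooth_on_cst _ _ U c.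
have sqi : Ck m U ('D_(delta_mx 0 i) q).
  by have /smooth_onP := @smooth_on_deriv _ _ U q i sq.
apply: Ck_eq (CkM oU (CkD oU (IH n.+2) (CkM oU (sC (- n%:R)) (IH n.+1))) sqi) =>
  //.
move=> x; rewrite inE => Ux /=.
by have [_ ->] := D i x Ux; rewrite mulNr.
Qed.

Lemma smooth_bump (d : nat) (a : 'rV[R]_d) (r : R) : 0 < r ->
  exists f : 'rV[R]_d -> R, [/\ smooth_on setT f, forall x, 0 <= f x <= 1,
    0 < f a & forall x, r <= `|x - a| -> f x = 0].
Proof.
move=> r0.
(* [r^2] minus the squared Euclidean distance to [a]. A point at sup distance at least [r] is at
   Euclidean distance at least [r], so [q <= 0] there. *)
pose q (x : 'rV[R]_d) := r ^+ 2 +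
  \sum_(k < d) (-1) * ((x 0 k - a 0 k) * (x 0 k - a 0 k)).
have sq : smooth_on setT q.
  apply: smooth_onD; [exact: openT|exact: smooth_on_cst|].
  apply: smooth_on_sum => [|k _]; first exact: openT.
  apply: smooth_onM; [exact: openT|exact: smooth_on_cst|].
  have sk : smooth_on setT (fun x : 'rV[R]_d => x 0 k - a 0 k).
    apply: smooth_onD; [exact: openT| |exact: smooth_on_cst].
    by apply: smooth_on_coord; exact: openT.
  exact: (smooth_onM openT sk sk).
exists (flat 0 \o q); split.
- by apply: smooth_on_flat sq; exact: openT.
- by move=> x /=; rewrite flat_ge0 flat0_le1.
- rewrite /= flat_gt0// /q big1 ?addr0 ?exprn_gt0// => k _.
  by rewrite subrr !mulr0.
- move=> x xa; rewrite /= flat_le0// /q.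
  have [k rk] : exists k : 'I_d, r <= `|x 0 k - a 0 k|.
    have /mx_norm_neq0[[i k]] : mx_norm (x - a) != 0.
      by rewrite gt_eqF//; exact: lt_le_trans r0 xa.
    rewrite ord1/= !mxE => E; exists k.
    by rewrite -E; exact: xa.
  rewrite (bigD1 k)//= mulN1r addrA -[leRHS]addr0 lerD//.
    rewrite subr_le0 -expr2 -[leRHS]real_normK ?num_real//.
    by apply: lerXn2r; rewrite ?nnegrE ?normr_ge0 ?(ltW r0).
  by apply: sumr_le0 => i _; rewrite mulN1r oppr_le0 -expr2 sqr_ge0.
Qed.

End flat_function.

(** * Smooth functions on a manifold *)

Section countable_covers.
Context {T : ptopologicalType}.

Lemma second_countable_seq : @second_countable T ->
  exists b : nat -> set T, (forall n, open (b n)) /\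
    forall (x : T) (A : set T), nbhs x A -> exists n, b n x /\ b n `<=` A.
Proof.
move=> [B cB [Bo Bx]].
have /countable_injP[f finj] := cB.
have : forall n, exists b : set T, open b /\ (forall U, B U -> f U = n ->
  b = U).
  move=> n; have [[U [BU fU]]|nU] := pselect (exists U, B U /\ f U = n).
    exists U; split; first exact: Bo.
    by move=> U' BU' fU'; apply: finj; rewrite ?inE// fU'.
  exists setT; split; first exact: openT.
  by move=> U BU fU; exfalso; apply: nU; exists U.
move=> /choice[b bP]; exists b; split; first by move=> n; exact: (bP n).1.
move=> x A /Bx[U [BU Ux] UA]; exists (f U).
by rewrite ((bP (f U)).2 U).
Qed.

(** Each basic open set lying in some good set is assigned one such set. The basic sets of this kind
    already cover, so the assigned sets do; the other indices receive an arbitrary good set. *)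
Lemma lindelof_cover (I : Type) (good : I -> set T -> Prop) :
  @second_countable T ->
  (forall x : T, exists i O, [/\ open O, O x & good i O]) ->
  exists (i : nat -> I) (O : nat -> set T),
    (forall n, open (O n) /\ good (i n) (O n)) /\ forall x, exists n, O n x.
Proof.
move=> /second_countable_seq[b [bo bx]] H.
have : forall n, exists iO : I * set T, (open iO.2 /\ good iO.1 iO.2) /\
    ((exists i O, [/\ open O, b n `<=` O & good i O]) -> b n `<=` iO.2).
  move=> n; have [[i [A [oA bA gA]]]|nO] :=
      pselect (exists i O, [/\ open O, b n `<=` O & good i O]).
    by exists (i, A).
  have [i [A [oA Ax gA]]] := H point.
  by exists (i, A); split=> // /nO.
move=> /choice[iO iOP]; exists (fun n => (iO n).1), (fun n => (iO n).2); split.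
  by move=> n; exact: (iOP n).1.
move=> x; have [i [A [oA Ax gA]]] := H x.
have [n [bnx bnA]] := bx x A (open_nbhs_nbhs (conj oA Ax)).
by exists n; apply: ((iOP n).2 _ _ bnx); exists i, A.
Qed.

(* Two functions with the same code have a common finite cover of [K] by basic
   open sets on each of which both are within [e] of the same multiple of
   [e]. *)
Lemma continuous_code (R : realType) (K : set T) (e : R) :
  @second_countable T -> compact K -> 0 < e ->
  exists code : (T -> R) -> seq (nat * int), forall f g : T -> R,
    (forall x, K x -> {for x, continuous f}) ->
    (forall x, K x -> {for x, continuous g}) ->
    code f = code g -> forall x, K x -> `|f x - g x| <= e.
Proof.
move=> /second_countable_seq[b [bo bx]] cK e0.
pose e' := e / 2; have e'0 : 0 < e' by rewrite divr_gt0.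
pose near_on (f : T -> R) (nv : nat * int) :=
  forall x, b nv.1 x -> `|f x - nv.2%:~R * e'| <= e'.
have : forall f : T -> R, exists L : seq (nat * int),
    (forall x, K x -> {for x, continuous f}) ->
    (forall nv, nv \in L -> near_on f nv) /\
    (forall x, K x -> exists2 nv, nv \in L & b nv.1 x).
  move=> f; have [cf|ncf] := pselect (forall x, K x -> {for x, continuous f});
    last by exists [::].
  move: cK; rewrite compact_cover => /(_ _ [set nv | near_on f nv] (fun nv => b
    nv.1)).
  case=> [nv _|x Kx|L LD KL].
  - exact: bo.
  - pose v := Num.floor (f x / e').
    have fxv : `|f x - v%:~R * e'| < e'.
      rewrite -[f x](divfK (lt0r_neq0 e'0)) -mulrBl normrM (gtr0_norm e'0).
      rewrite -[ltRHS]mul1r ltr_pM2r// ger0_norm ?subr_ge0 ?floor_le//.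
      by rewrite ltrBlDl -[X in _ + X]/(1%:~R) -intrD floorD1_gt.
    have : \forall y \near x, `|f y - v%:~R * e'| <= e'.
      have := cf x Kx; move=> /cvgrPdist_lt/(_ (e' - `|f x - v%:~R * e'|)).
      rewrite subr_gt0 => /(_ fxv); apply: filterS => y fxy.
      rewrite (_ : f y - v%:~R * e' = (f x - v%:~R * e') - (f x - f y));
        last by ring.
      by apply: le_trans (ler_normB _ _) _; rewrite -lerBrDl ltW.
    move=> /bx[n [bnx bnf]]; exists (n, v) => //.
  - exists (finmap.enum_fset L) => _; split.
      by move=> nv nvL; have := LD nv nvL; rewrite inE.
    by move=> x /KL[nv nvL bx']; exists nv.
move=> /choice[code codeP]; exists code => f g cf cg fg x Kx.
have [fL KL] := codeP f cf; have [gL _] := codeP g cg.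
have [nv nvL bnx] := KL x Kx.
have := fL nv nvL x bnx; have := gL nv; rewrite -fg => /(_ nvL x bnx).
move=> gx fx; rewrite [e]splitr -/e'.
rewrite (_ : f x - g x = (f x - nv.2%:~R * e') - (g x - nv.2%:~R * e'));
  last by ring.
by apply: le_trans (ler_normB _ _) _; exact: lerD.
Qed.

End countable_covers.

Lemma open_positive (R : realType) (T : topologicalType) (f : T -> R) :
  continuous f -> open [set x | 0 < f x].
Proof.
move=> cf; rewrite (_ : [set _ | _] = f @^-1` [set t | 0 < t])//.
by apply: open_comp => [z _|]; [exact: cf|exact: open_gt].
Qed.

Lemma near_rV_ball (R : realType) (d : nat) (x : 'rV[R]_d) (P : 'rV[R]_d ->
  Prop) :
  (\forall y \near x, P y) -> exists2 r : R, 0 < r & forall y, `|y - x| <= r ->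
    P y.
Proof.
move=> /nbhs_ballP[r /= r0 rP]; exists (r / 2); first by rewrite divr_gt0.
move=> y xy; apply: rP; rewrite -ball_normE/= distrC.
by apply: le_lt_trans xy _; rewrite ltr_pdivrMr// ltr_pMr// ltr1n.
Qed.

Lemma rV_ball_compact (R : realType) (d : nat) (x : 'rV[R]_d) (r : R) :
  0 < r -> compact [set y | `|y - x| <= r].
Proof.
move=> r0; apply: bounded_closed_compact.
  exists (`|x| + r); split; first exact: num_real.
  move=> N xN y /= yx; apply/ltW/(le_lt_trans _ xN).
  by rewrite -[y](subrK x) (le_trans (ler_normD _ _))// addrC lerD2l.
rewrite (_ : [set _ | _] = closed_ball x r); first exact: closed_ball_closed.
by rewrite closed_ballE//; apply/seteqP; split=> y /=; rewrite distrC.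
Qed.

Section smooth_functions.
Context {R : realType} {d : nat} {X : ptopologicalType}.
Variable M : smooth_atlas R d X.

Definition sfun (phi : X -> R) := forall i : atl_idx M,
  smooth_on (atl_map i @` atl_dom i) (phi \o atl_inv (s := M) i).

Lemma sfun_cst c : sfun (fun=> c).
Proof. by move=> i; exact: smooth_on_cst. Qed.

Lemma sfunD f g : sfun f -> sfun g -> sfun (f \+ g).
Proof. by move=> sf sg i; apply: (smooth_onD _ (sf i) (sg i));
  exact: atl_img_open. Qed.

Lemma sfunM f g : sfun f -> sfun g -> sfun (f \* g).
Proof. by move=> sf sg i; apply: (smooth_onM _ (sf i) (sg i));
  exact: atl_img_open. Qed.

Lemma sfun_prod (I : Type) (r : seq I) (F : I -> X -> R) :
  (forall i, sfun (F i)) -> sfun (fun x => \prod_(i <- r) F i x).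
Proof.
move=> sF; elim: r => [|i r IH].
  rewrite (_ : (fun _ => _) = fun=> 1); first exact: sfun_cst.
  by apply/funext => x; rewrite big_nil.
rewrite (_ : (fun _ => _) = F i \* (fun x => \prod_(i <- r) F i x)).
  by apply: sfunM; [exact: sF|exact: IH].
by apply/funext => x; rewrite big_cons.
Qed.

Lemma sfun1B f : sfun f -> sfun (fun x => 1 - f x).
Proof.
move=> sf; rewrite (_ : (fun _ => _) = (fun=> 1) \+ ((fun=> -1) \* f)).
  by apply: sfunD; [exact: sfun_cst|apply: sfunM; [exact: sfun_cst|exact: sf]].
by apply/funext => x /=; rewrite mulN1r.
Qed.

Lemma sfunX f n : sfun f -> sfun (fun x => f x ^+ n).
Proof.
move=> sf; elim: n => [|n IH].
  rewrite (_ : (fun _ => _) = fun=> 1); first exact: sfun_cst.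
  by apply/funext => x; rewrite expr0.
rewrite (_ : (fun _ => _) = f \* (fun x => f x ^+ n)); first by apply: sfunM;
  [exact: sf|exact: IH].
by apply/funext => x; rewrite exprS.
Qed.

Lemma chart_near i x (P : 'rV[R]_d -> Prop) : atl_dom (s := M) i x ->
  (\forall y \near atl_map i x, P y) -> \forall z \near x, P (atl_map i z).
Proof. by move=> /atl_map_continuous cx /cx. Qed.

Lemma chart_near_dom i x : atl_dom (s := M) i x ->
  \forall z \near x, atl_dom (s := M) i z.
Proof.
by move=> ix; apply: open_nbhs_nbhs; split=> //; exact: atl_dom_open.
Qed.

Lemma chartK i x : atl_dom (s := M) i x -> atl_inv i (atl_map i x) = x.
Proof. by move=> ix; rewrite atl_mapK ?inE. Qed.

Lemma chart_continuous i (F : 'rV[R]_d -> R) (f : X -> R) x :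
  atl_dom (s := M) i x -> {for atl_map i x, continuous F} ->
  (\forall z \near x, F (atl_map i z) = f z) -> {for x, continuous f}.
Proof.
move=> ix cF E; apply: (eq_continuous_at (F := F \o atl_map i)) E _.
by apply: continuous_comp; [exact: atl_map_continuous|].
Qed.

Lemma sfun_continuous f : sfun f -> continuous f.
Proof.
move=> sf x; have [i ix] := delta_subproof M x.
apply: (chart_continuous ix).
  by apply: (sf i [::] _ _).1; exists x.
by apply: filterS (chart_near_dom ix) => z iz /=; rewrite chartK.
Qed.

Lemma chart_img_near i (A : set X) y : open A ->
  (atl_map i @` (atl_dom (s := M) i `&` A)) y ->
  \forall z \near y, (atl_map i @` (atl_dom (s := M) i `&` A)) z.
Proof.
move=> oA [x [ix Ax] <-].
have H1 : \forall z \near atl_map i x, (atl_map i @` atl_dom (s := M) i) z.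
  by apply: open_nbhs_nbhs; split; [exact: atl_img_open|exists x].
have H2 : \forall z \near atl_map i x, A (atl_inv i z).
  have := atl_inv_continuous ix; rewrite /prop_for /continuous_at => /(_ A).
  by rewrite chartK//; apply; apply: open_nbhs_nbhs.
have := @filterI _ _ (nbhs_filter (atl_map i x)) _ _ H1 H2.
apply: filterS => z [[w iw <-]]; rewrite /= chartK// => Aw.
by exists w.
Qed.

Lemma chart_img_open i (A : set X) : open A ->
  open (atl_map i @` (atl_dom (s := M) i `&` A)).
Proof. by move=> oA; rewrite openE => y /(chart_img_near oA). Qed.

Lemma chart_ball i x (A : set X) : open A -> A x -> atl_dom (s := M) i x ->
  exists2 r : R, 0 < r & forall y, `|y - atl_map i x| <= r ->
    (atl_map i @` (atl_dom (s := M) i `&` A)) y.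
Proof.
move=> oA Ax ix.
apply: near_rV_ball; apply: chart_img_near => //.
by exists x.
Qed.

Lemma chart_ball_compact i x (r : R) : 0 < r ->
  (forall y, `|y - atl_map i x| <= r -> (atl_map i @` atl_dom (s := M) i) y) ->
  compact (atl_inv (s := M) i @` [set y | `|y - atl_map i x| <= r]).
Proof.
move=> r0 rU; apply: continuous_compact; last exact: rV_ball_compact.
apply: continuous_in_subspaceT => y; rewrite inE/= => /rU[w iw <-].
exact: atl_inv_continuous.
Qed.

(** A bump in one chart is extended by 0. The Hausdorff property makes the compact image [K] of the
    closed chart ball closed, so that outside the chart domain the extension vanishes on a whole
    neighbourhood and is smooth there too. *)
Lemma sfun_bump (x : X) (A : set X) : hausdorff_space X -> open A -> A x ->
  exists phi : X -> R, [/\ sfun phi, forall z, 0 <= phi z <= 1,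
    0 < phi x & forall z, ~ A z -> phi z = 0].
Proof.
move=> hX oA Ax; have [i ix] := delta_subproof M x.
have [r r0 rA] := chart_ball oA Ax ix.
have rU y : `|y - atl_map i x| <= r -> (atl_map i @` atl_dom (s := M) i) y.
  by move=> /rA[w [iw _] <-]; exists w.
have [f [sf f01 fx f0]] := smooth_bump (atl_map i x) r0.
pose phi z := if pselect (atl_dom (s := M) i z) then f (atl_map i z) else 0.
have phiE z : atl_dom (s := M) i z -> phi z = f (atl_map i z).
  by rewrite /phi; case: pselect.
have cK := chart_ball_compact r0 rU.
set K := atl_inv i @` _ in cK.
have phi0 z : ~ K z -> phi z = 0.
  rewrite /phi; case: pselect => // iz Kz; apply: f0.
  rewrite leNgt; apply/negP => zr; apply: Kz.
  by exists (atl_map i z); [exact: ltW|exact: chartK].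
exists phi; split.
- move=> j; apply/smooth_on_at => _ [z jz <-].
  have [iz|niz] := pselect (atl_dom (s := M) i z).
    pose V := atl_map j @` (atl_dom (s := M) j `&` atl_dom (s := M) i).
    have oV : open V by apply: chart_img_open; exact: atl_dom_open.
    have Vz : V (atl_map j z) by exists z.
    apply: (@eq_smooth_at _ _ (f \o (fun y => atl_map i (atl_inv j y)))).
      apply: (near_open oV Vz) => y' [w [jw iw] wy] /=.
      by rewrite -wy /= chartK// phiE.
    apply: ((smooth_on_at V (f \o (fun y => atl_map i (atl_inv j y)))).1 _ _
      Vz).
    apply: (@smooth_on_comp _ _ setT V) => //; first exact: openT.
    by move=> k; exact: atl_smooth.
  apply: (@eq_smooth_at _ _ (fun=> 0)); last exact: smooth_on_cst.
  have cKC : open (~` K) by rewrite openC; exact: compact_closed.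
  have nKz : (~` K) z.
    move=> [y /rU[w iw <-]]; rewrite chartK// => wz; apply: niz.
    by rewrite -wz.
  have : (atl_map j @` (atl_dom (s := M) j `&` ~` K)) (atl_map j z) by exists z.
  move=> /(chart_img_near cKC)/near_mono; apply => y' [w [jw Kw] wy] /=.
  by rewrite -wy chartK// phi0.
- move=> z; have [iz|niz] := pselect (atl_dom (s := M) i z).
    by rewrite phiE.
  rewrite (_ : phi z = 0) ?lexx ?ler01//.
  by rewrite /phi; case: pselect.
- by rewrite phiE.
- move=> z Az; apply: phi0 => -[y /rA[w [iw Aw] <-]]; rewrite chartK// => wz.
  by apply: Az; rewrite -wz.
Qed.

Lemma test_of (p : nat) (g : X -> 'rV[R]_p) :
  (forall k, sfun (fun x => g x 0 k)) ->
    (exists C : R, forall x k, `|g x 0 k| <= C) ->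
  exists f : test M p, f =1 g :> (X -> 'rV[R]_p).
Proof.
move=> sg [C gC].
have H : g \in @test_pred _ _ _ M p.
  apply/asboolP; split; first by move=> i k; exact: sg.
  exists (\sum_(k < p) C) => x; apply: le_trans (norm2_le_sum _) _.
  by apply: ler_sum => k _; exact: gC.
by exists (Test H).
Qed.

End smooth_functions.

Lemma uniform_cvg_le (R : realType) (U : choiceType) (K : set U)
    (F : nat -> U -> R) (f : U -> R) :
  (forall e : R, 0 < e -> \forall n \near \oo, forall y, K y ->
    `|f y - F n y| <= e) ->
  {uniform K, F @ \oo --> f}.
Proof.
move=> H P /uniform_nbhs[E [entE EP]].
move: entE; rewrite -entourage_ballE => -[e /= e0 eE].
have := H (e / 2); rewrite divr_gt0// => /(_ isT).
apply: filterS => n fn; apply: EP => y /fn fy; apply: eE.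
rewrite -ball_normE/=; apply: le_lt_trans fy _.
by rewrite ltr_pdivrMr// ltr_pMr// ltr1n.
Qed.

(** * Convergence of test functions through countably many patches *)

Section separability.
Context {R : realType} {d : nat} {X : ptopologicalType}.
Variable M : smooth_atlas R d X.

(** Closed chart balls and their interiors, made countable by Lindelof. Their compactness also feeds
    the weight function; that each lies in a single chart makes the convergence of test functions a
    countable matter. *)
Lemma compact_patches : @second_countable X ->
  exists (i : nat -> atl_idx M) (U K : nat -> set X),
    (forall l, [/\ open (U l), U l `<=` K l, compact (K l) &
      K l `<=` atl_dom (s := M) (i l)]) /\ forall x, exists l, U l x.
Proof.
move=> scX.
pose good (i : atl_idx M) U := exists K, [/\ U `<=` K, compact K &
  K `<=` atl_dom (s := M) i].
have [x|i [U [goodU coverU]]] := @lindelof_cover X (atl_idx M) good scX.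
  have [i ix] := delta_subproof M x.
  have [r r0 rA] := chart_ball openT I ix.
  have rU y : `|y - atl_map i x| <= r -> (atl_map i @` atl_dom (s := M) i) y.
    by move=> /rA[w [iw _] <-]; exists w.
  have cK := chart_ball_compact r0 rU.
  set K := atl_inv i @` _ in cK.
  exists i, (interior K); split; first exact: open_interior.
    have := chart_near (P := fun y => `|y - atl_map i x| <= r) ix.
    have xr : \forall y \near atl_map i x, `|y - atl_map i x| <= r.
      apply: (near_mono (nbhsx_ballx (atl_map i x) r r0)) => y.
      by rewrite -ball_normE/= distrC; exact: ltW.
    move=> /(_ xr) xK; apply: filterS2 xK (chart_near_dom ix) => z zr iz.
    by exists (atl_map i z) => //; exact: chartK.
  exists K; split => //; first exact: interior_subset.
  by move=> _ [y /rU[w iw <-] <-]; rewrite chartK.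
have : forall l, exists K, [/\ open (U l), U l `<=` K, compact K &
    K `<=` atl_dom (s := M) (i l)].
  by move=> l; have [oU [K [? ? ?]]] := goodU l; exists K.
by move=> /choice[K KP]; exists i, U, K.
Qed.

Variable p : nat.
Variables (i_ : nat -> atl_idx M) (U_ K_ : nat -> set X).
Hypothesis patches : forall l, [/\ open (U_ l), U_ l `<=` K_ l, compact (K_ l) &
  K_ l `<=` atl_dom (s := M) (i_ l)].
Hypothesis coverU : forall x, exists l, U_ l x.

Definition in_chart (g : X -> 'rV[R]_p) (i : atl_idx M) (k : 'I_p) :
  'rV[R]_d -> R := fun y => g (atl_inv i y) 0 k.

(** Near any point of a chart, a derivative is a finite sum of derivatives in the chart of a patch,
    with coefficients coming from the change of charts and bounded near the point. Control on the
    patches thus gives local control everywhere, and compactness of [K] makes it uniform. *)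
Lemma test_cvg_patches (g_ : nat -> test M p) (g : test M p) (C : R) :
  (forall n x, norm2 (g_ n x) <= C) ->
  (forall l k s (e : R), 0 < e -> \forall n \near \oo, forall x, K_ l x ->
    `|pderiv s (in_chart (g_ n) (i_ l) k) (atl_map (i_ l) x) -
      pderiv s (in_chart g (i_ l) k) (atl_map (i_ l) x)| <= e) ->
  test_cvg g_ g.
Proof.
move=> gC H; split; first by exists C.
move=> i k s K cK KU; apply: uniform_cvg_le => e e0.
apply: ((compact_near_coveringP K).1 cK nat \oo
  (fun n y => `|pderiv s (in_chart g i k) y - pderiv s (in_chart (g_ n) i k) y|
    <= e)).
move=> y Ky; have [x ix xy] := KU y Ky.
have [l Ulx] := coverU x; have [oU UK cKl Kdom] := patches l.
set j := i_ l in Kdom *.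
pose V := atl_map i @` (atl_dom (s := M) i `&` U_ l).
have oV : open V by exact: chart_img_open.
have Vy : V y by exists x.
pose tau z := atl_map j (atl_inv (s := M) i z).
have stau k' : smooth_on V (fun z => tau z 0 k').
  have := @atl_smooth _ _ _ M i j k'; move=> sm s' z [w [iw Uw] wz].
  by apply: sm; exists w => //; split=> //; exact/Kdom/UK.
have tauU z : V z -> (atl_map j @` atl_dom (s := M) j) (tau z).
  move=> [w [iw Uw] <-]; exists w; first exact/Kdom/UK.
  by rewrite /tau chartK.
have sg (f : test M p) : smooth_on (atl_map j @` atl_dom (s :=
  M) j) (in_chart f j k).
  by have /asboolP[sf _] := valP f; exact: sf.
have [L sL EL] := pderiv_comp s (@atl_img_open _ _ _ M j) oV tauU stau.
have EF (f : test M p) z : V z -> pderiv s (in_chart f i k) z =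
    \sum_(us <- L) us.1 z * pderiv us.2 (in_chart f j k) (tau z).
  move=> Vz; rewrite -(EL _ (sg f) _ Vz).
  have E : \forall z' \near z, in_chart f i k z' = (in_chart f j k \o tau) z'.
    apply: (near_open oV Vz) => z' [w [iw Uw] wz'].
    rewrite -wz' /in_chart /tau /= !chartK//; exact/Kdom/UK.
  exact: nbhs_singleton (eq_pderiv s E).
(* [W] is a neighbourhood on which all coefficients are bounded; it does not depend on the precision
   [e']. *)
have [W Wy key] : exists2 W : set 'rV[R]_d, (\forall z \near y, W z) &
    forall e' : R, 0 < e' -> \forall n \near \oo, forall z, W z -> V z ->
   `|\sum_(us <- L) us.1 z * pderiv us.2 (in_chart g j k) (tau z) -
     \sum_(us <- L) us.1 z * pderiv us.2 (in_chart (g_ n) j k) (tau z)| <= e'.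
  elim: L sL {EL EF} => [|us L IH] sL.
    exists setT; first exact: filterT.
    by move=> e' e'0; near=> n => z _ _; rewrite !big_nil subrr normr0 ltW.
  have [W Wy {}IH] := IH (fun us' us'L => sL us' (or_intror us'L)).
  pose B := `|us.1 y| + 1; have B0 : 0 < B by rewrite ltr_wpDl.
  exists [set z | W z /\ `|us.1 z| <= B].
    have Hu := (sL us (or_introl erefl) [::] y Vy).1.
    move: Hu => /cvgrPdist_le/(_ 1 ltr01) Hu.
    apply: (near_mono (@filterI _ _ (nbhs_filter y) _ _ Wy Hu)) => z [Wz yz].
    split=> //; rewrite /B -[us.1 z](subrK (us.1 y)).
    by rewrite addrC (le_trans (ler_normD _ _))// lerD2l distrC.
  move=> e' e'0; have e'2 : 0 < e' / 2 by rewrite divr_gt0.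
  have := H l k us.2 (e' / 2 / B); rewrite divr_gt0// => /(_ isT) HK.
  apply: filterS2 (IH _ e'2) HK => n Hn HK z [Wz uz] Vz.
  rewrite !big_cons opprD addrACA.
  rewrite [e']splitr; apply: le_trans (ler_normD _ _) _; apply: lerD;
    last exact: Hn.
  rewrite -mulrBr normrM.
  have -> : e' / 2 = B * (e' / 2 / B) by rewrite [RHS]mulrC divfK// gt_eqF.
  apply: ler_pM => //.
  have [w [iw Uw] wz] := Vz; rewrite -wz /tau chartK// distrC.
  exact/HK/UK.
have nV : \forall z \near y, V z by exact: (near_open oV Vy (fun _ Vz => Vz)).
exists ([set z | W z /\ V z],
  [set n | forall z, W z -> V z ->
   `|\sum_(us <- L) us.1 z * pderiv us.2 (in_chart g j k) (tau z) -
     \sum_(us <- L) us.1 z * pderiv us.2 (in_chart (g_ n) j k) (tau z)| <= e]).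
  split; last exact: key.
  exact: (@filterI _ _ (nbhs_filter y) _ _ Wy nV).
by move=> [z n] [[Wz Vz] Hn]; rewrite /= !EF//; exact: Hn.
Unshelve. all: by end_near. Qed.

End separability.

(** * A countable sequentially dense family of test functions *)

Section countable_dense.
Context {R : realType} {d : nat} {X : ptopologicalType}.
Variable M : smooth_atlas R d X.

Lemma in_chart_continuous p (g : test M p) i k s x : atl_dom (s := M) i x ->
  {for x, continuous (fun x => pderiv s (in_chart g i k) (atl_map i x))}.
Proof.
move=> ix; have /asboolP[sg _] := valP g.
apply: (continuous_comp (f := atl_map i)); first exact: atl_map_continuous.
by apply: (sg i k s _ _).1; exists x.
Qed.

(** Density by counting: every test function has, at each precision, a code in a countable type, and
    one test function is kept for each code that occurs. Equal codes mean closeness on the patches,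
    so the kept functions with the codes of [g] converge to [g]. *)
Lemma test_countable_dense p : @second_countable X ->
  exists D : nat -> test M p, forall g, exists u : nat -> nat,
    test_cvg (fun n => D (u n)) g.
Proof.
move=> scX; have [i_ [U_ [K_ [patches coverU]]]] := compact_patches M scX.
pose Q := (nat * seq 'I_d * 'I_p)%type.
pose h (q : Q) (g : test M p) x :=
  pderiv q.1.2 (in_chart g (i_ q.1.1) q.2) (atl_map (i_ q.1.1) x).
have : forall qr : Q * nat, exists code : test M p -> seq (nat * int),
    forall f g, code f = code g -> forall x, K_ qr.1.1.1 x ->
      `|h qr.1 f x - h qr.1 g x| <= qr.2.+1%:R^-1.
  move=> [q r]; have [_ _ cK Kdom] := patches q.1.1.
  have r0 : 0 < r.+1%:R^-1 :> R by rewrite invr_gt0.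
  have [code codeP] := continuous_code scX cK r0.
  exists (fun g => code (h q g)) => f g fg; apply: codeP fg.
    by move=> x /Kdom; exact: in_chart_continuous.
  by move=> x /Kdom; exact: in_chart_continuous.
move=> /choice[code codeP].
have : forall g : test M p, exists N : nat, forall x, norm2 (g x) <= N%:R.
  move=> g; have /asboolP[_ [C gC]] := valP g.
  exists (Num.truncn `|C|).+1 => x; apply: le_trans (gC x) _.
  by apply: le_trans (ler_norm _) _; rewrite ltW// truncnS_gt.
move=> /choice[N NP].
(* The code at stage [r] treats the triples (patch, derivatives, component) of index below [r], at
   precision [1/(r+1)]. It includes the bound [N g], so that the approximants are uniformly bounded,
   as [test_cvg] demands. *)
pose full (r : nat) (g : test M p) : nat * nat * seq (seq (nat * int)) :=
  (r, N g, [seq (if unpickle a is Some q then code (q,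
    r) g else [::]) | a <- iota 0 r]).
have : forall n : nat, exists g : test M p,
    forall r f, pickle (full r f) = n -> full r g = full r f.
  move=> n; have [[r [f rf]]|nf] := pselect (exists r f, pickle (full r f) = n).
    exists f => r' f'; rewrite -rf => /(pcan_inj pickleK) E.
    have /= rr' := congr1 (fun t => t.1.1) E; rewrite rr' in E *; by rewrite -E.
  by exists 0 => r f rf; exfalso; apply: nf; exists r, f.
move=> /choice[D DP]; exists D => g.
exists (fun r => pickle (full r g)).
have E r : full r (D (pickle (full r g))) = full r g by exact: DP.
apply: (@test_cvg_patches _ _ _ _ _ _ _ _ patches coverU _ _ (N g)%:R).
  move=> r x; apply: le_trans (NP _ _) _.
  by have /= -> := congr1 (fun t => t.1.2) (E r).
move=> l k s e e0; near=> r => x Kx.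
have /= Er := congr1 snd (E r).
pose q : Q := (l, s, k).
have qr : (pickle q < r)%N by near: r; exact: nbhs_infty_gt.
have := congr1 (fun t => nth [::] t (pickle q)) Er => {}Er.
rewrite !(nth_map 0%N) ?size_iota// !nth_iota// add0n pickleK in Er.
apply: le_trans (codeP (q, r) _ _ Er x Kx) _ => /=.
by rewrite ltW//; near: r; exact: (near_infty_natSinv_lt (PosNum e0)).
Unshelve. all: by end_near. Qed.

End countable_dense.

(** * A moment bound for the pairings *)

Section real_inequalities.
Context {R : realType}.
Implicit Types (s t y : R) (n : nat).

Lemma sqrtr_le s t : 0 <= t -> s <= t ^+ 2 -> Num.sqrt s <= t.
Proof. by move=> t0 st; rewrite -(ger0_norm t0) -sqrtr_sqr ler_wsqrtr. Qed.

(* Multiplying by a suitable power of 16 brings [y > 0] into [1/8, 2], where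
   [1 - cos] is bounded below. *)
Lemma sqrt_le_cos y : 0 < y -> exists q : nat,
  (1 - cos (8^-1 : R)) * Num.sqrt y <=
    2 * ((4^-1) ^+ q * (1 - cos (16 ^+ q * y)) +
      4 ^+ q * (1 - cos ((16^-1) ^+ q * y))).
Proof.
move=> y0.
have c0 t : 0 <= 1 - cos t :> R by rewrite subr_ge0 cos_le1.
have cle t : 8^-1 <= t <= 2 -> 1 - cos (8^-1) <= 1 - cos t.
  move=> /andP[t8 t2]; rewrite lerD2l lerN2.
  have [->//|t8'] := eqVneq t 8^-1.
  have t80 : 0 <= (8^-1 : R) by rewrite invr_ge0.
  have tpi : t \in `[0, pi] by rewrite in_itv/= (le_trans t80 t8) (le_trans t2
    (pi_ge2 _)).
  have epi : 8^-1 \in `[0, pi : R].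
    by rewrite in_itv/= t80 (le_trans _ (pi_ge2 R))// (le_trans t8).
  by apply/ltW; rewrite (ltr_cos epi tpi) lt_neqAle eq_sym t8'.
(* With [y = t * a^2] one has [sqrt y = sqrt t * a <= 2 * a]; the term [b] of the opposite scale is
   just dropped. *)
have key t (a b : R) : 0 <= a -> 8^-1 <= t <= 2 -> y = t * a ^+ 2 -> 0 <= b ->
    (1 - cos (8^-1 : R)) * Num.sqrt y <= 2 * (a * (1 - cos t) + b).
  move=> a0 tI ->; have /andP[t8 t2] := tI => b0.
  have t0 : 0 <= t by rewrite (le_trans _ t8)// invr_ge0.
  rewrite sqrtrM// sqrtr_sqr (ger0_norm a0) [leRHS]mulrDr.
  have H : Num.sqrt t <= 2 by apply: sqrtr_le; [lra|rewrite expr2; lra].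
  have := cle t tI; have := c0 (8^-1); have := sqrtr_ge0 t.
  set u := Num.sqrt t in H *; set A := 1 - cos 8^-1;
    set B := 1 - cos t => u0 A0 AB.
  apply: (@le_trans _ _ (2 * (a * B))); last by rewrite lerDl mulr_ge0.
  have AB2 : A * u <= B * 2 by apply: ler_pM.
  rewrite (_ : A * (u * a) = a * (A * u)); last by ring.
  by rewrite (_ : 2 * (a * B) = a * (B * 2)) ?ler_wpM2l//; ring.
have big (z : R) : 0 < z -> exists q : nat, 2 < 16 ^+ q * z.
  move=> z0; exists (Num.truncn (2 / z)).+1.
  rewrite -ltr_pdivrMr//; apply: lt_le_trans (truncnS_gt _) _.
  by rewrite -natrX ler_nat; apply: ltnW; rewrite ltn_expl.
(* If [y <= 2], take the last [q] with [16^q y <= 2]; otherwise the first one with [16^-q y <= 2].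
   In both cases a further factor 16 would exceed 2, so the scaled value is above 1/8. *)
have [y2|y2] := leP y 2.
  have [q0 q0P] := big y y0.
  have [[|q] qP qmin] := ex_minnP (ex_intro (fun q => 2 < 16 ^+ q * y) q0 q0P).
    by move: qP; rewrite expr0 mul1r ltNge y2.
  have qy : 16 ^+ q * y <= 2.
    by rewrite leNgt; apply/negP => /qmin; rewrite ltnn.
  exists q; apply: (key (16 ^+ q * y)).
  - by rewrite exprn_ge0.
  - rewrite qy andbT; move: qP; rewrite exprS; lra.
  - rewrite exprAC -mulrA (mulrC y) mulrA -exprMn.
    by rewrite (_ : 16 * _ = 1) ?expr1n ?mul1r//; lra.
  - by rewrite mulr_ge0 ?exprn_ge0.
have [q0 q0P] : exists q, (16^-1) ^+ q * y <= 2.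
  have [|q0 q0P] := big y^-1; first by rewrite invr_gt0.
  exists q0; rewrite exprVn mulrC ler_pdivrMr ?exprn_gt0//.
  move: q0P; rewrite ltr_pdivlMr//; lra.
have [[|q] qP qmin] := ex_minnP (ex_intro (fun q => (16^-1) ^+ q * y <=
  2) q0 q0P).
  by move: qP; rewrite expr0 mul1r leNgt y2.
have qy : 2 < (16^-1) ^+ q * y.
  by rewrite ltNge; apply/negP => /qmin; rewrite ltnn.
exists q.+1; rewrite [X in _ <= _ * X]addrC; apply: (key ((16^-1) ^+ q.+1 * y)).
- by rewrite exprn_ge0.
- rewrite qP andbT exprS; lra.
- rewrite exprAC -mulrA (mulrC y) mulrA -exprMn.
  by rewrite (_ : 16^-1 * _ = 1) ?expr1n ?mul1r//; lra.
- by rewrite mulr_ge0 ?exprn_ge0.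
Qed.

Lemma sum_half_le n : \sum_(0 <= k < n) (2^-1) ^+ k <= 2 :> R.
Proof.
suff -> : \sum_(0 <= k < n) (2^-1) ^+ k = 2 - 2 * (2^-1) ^+ n :> R.
  by rewrite gerBl mulr_ge0// exprn_ge0.
elim: n => [|n IHn]; first by rewrite big_geq// expr0 mulr1 subrr.
by rewrite big_nat_recr//= IHn exprS; field.
Qed.

(* A bound, up to a constant factor, for the sum over all integers [q] of
   [4^-q * ln (1 + (16^q * s)^2 / 4)]. *)
Definition Hfun s : R := 4 * Num.sqrt (Num.sqrt (s / 2)) + s ^+ 2 / 8.

Lemma Hfun_ge0 s : 0 <= Hfun s.
Proof. apply: addr_ge0; apply: mulr_ge0;
  rewrite ?sqrtr_ge0 ?sqr_ge0 ?invr_ge0//. Qed.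

Lemma Hfun_le s t : 0 <= s -> s <= t -> Hfun s <= Hfun t.
Proof.
move=> s0 st; apply: lerD.
  by rewrite ler_wpM2l// ler_wsqrtr// ler_wsqrtr// ler_wpM2r// invr_ge0.
rewrite ler_wpM2r ?invr_ge0//; apply: lerXn2r; rewrite ?nnegrE//.
exact: le_trans st.
Qed.

Lemma Hfun0 : Hfun 0 = 0.
Proof. by rewrite /Hfun mul0r !sqrtr0 mulr0 expr0n/= mul0r addr0. Qed.

Lemma continuous_Hfun : continuous Hfun.
Proof.
have csqrt : continuous (fun s => Num.sqrt (Num.sqrt (s / 2)) : R).
  move=> s; apply: (continuous_comp (f := fun s => Num.sqrt (s / 2)));
    last exact: sqrt_continuous.
  apply: (continuous_comp (f := fun s : R => s / 2));
    last exact: sqrt_continuous.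
  by apply: cvgMr_tmp; exact: cvg_id.
move=> s; apply: cvgD; first by apply: cvgMl_tmp; exact: csqrt.
by apply: cvgMr_tmp; exact: exprn_continuous.
Qed.

(** Here [z = t (s/2)^(1/4)], and [1 + z^8 <= (1 + z)^8] gives
    [ln (1 + z^8) <= 8 ln (1 + z) <= 8 z]. For [t = 2^q], that is at the scale [16^q], this grows
    only like [2^q] and is beaten by the weight [4^-q]. *)
Lemma ln1D_root8 s t : 0 <= s -> 0 <= t ->
  ln (1 + 1 / 4 * (t ^+ 4 * s) ^+ 2) <= 8 * (t * Num.sqrt (Num.sqrt (s / 2))).
Proof.
move=> s0 t0; set r := Num.sqrt _.
have r0 : 0 <= r by exact: sqrtr_ge0.
have r4 : r ^+ 4 = s / 2.
  by rewrite (exprM _ 2 2) sqr_sqrtr ?sqrtr_ge0// sqr_sqrtr// divr_ge0.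
set z := t * r; have z0 : 0 <= z by rewrite mulr_ge0.
have -> : 1 / 4 * (t ^+ 4 * s) ^+ 2 = z ^+ 8.
  have r8 : r ^+ 8 = (s / 2) ^+ 2 by rewrite -r4 -exprM.
  by rewrite /z [RHS]exprMn r8; field.
have : 1 + z ^+ 8 <= (1 + z) ^+ 8.
  rewrite exprDn big_ord_recl big_ord_recr/= !expr0 !expr1n !mul1r bin0 binn.
  rewrite !mulr1n lerD2l lerDr; apply: sumr_ge0 => i _.
  by rewrite mulrn_wge0// expr1n mul1r exprn_ge0.
move=> H; apply: (@le_trans _ _ (ln ((1 + z) ^+ 8))).
  by rewrite ler_ln ?posrE// ?exprn_gt0 ?ltr_wpDr ?exprn_ge0.
rewrite lnXn ?ltr_wpDr// -[leLHS]mulr_natl ler_wpM2l//.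
by apply: le_ln1Dx; apply: lt_le_trans z0; rewrite ltrN10.
Qed.

(** Large scales use the eighth root above, [4^-q 2^q = 2^-q]. Small scales use [ln (1 + u) <= u],
    with factor [4^q 16^(-2q) = 64^-q <= 2^-q]. Hence the two terms of [Hfun]. *)
Lemma ln1D_weighted s (q : nat) : 0 <= s ->
  (4^-1) ^+ q * (1 / 2 * ln (1 + 1 / 4 * (16 ^+ q * s) ^+ 2)) +
  4 ^+ q * (1 / 2 * ln (1 + 1 / 4 * ((16^-1) ^+ q * s) ^+ 2)) <=
  (2^-1) ^+ q * Hfun s.
Proof.
move=> s0; rewrite /Hfun mulrDr; apply: lerD.
  have := @ln1D_root8 s (2 ^+ q) s0; rewrite exprn_ge0// => /(_ isT).
  rewrite -exprM mulnC exprM (_ : 2 ^+ 4 = 16 :> R); last by rewrite -natrX.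
  move=> H; apply: (@le_trans _ _ ((4^-1) ^+ q * (1 / 2 * (8 * (2 ^+ q *
    Num.sqrt (Num.sqrt (s / 2))))))).
    by rewrite ler_wpM2l ?exprn_ge0// ler_wpM2l.
  rewrite (_ : (4^-1) ^+ q = (2^-1) ^+ q * (2^-1) ^+ q); last first.
    by rewrite -exprMn; congr (_ ^+ q); lra.
  have ab : (2^-1) ^+ q * 2 ^+ q = 1 :> R by rewrite -exprMn mulVf// expr1n.
  set a := 2^-1 ^+ q in ab *; set b := 2 ^+ q in ab *; set r := Num.sqrt _.
  have -> : a * a * (1 / 2 * (8 * (b * r))) = a * ((a * b) * (4 * r)) by field.
  by rewrite ab mul1r.
apply: (@le_trans _ _ (4 ^+ q * (1 / 2 * (1 / 4 * ((16^-1) ^+ q * s) ^+ 2)))).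
  rewrite ler_wpM2l ?exprn_ge0// ler_wpM2l// le_ln1Dx//.
  by apply: lt_le_trans (_ : -1 < 0) _; rewrite ?ltrN10// mulr_ge0// sqr_ge0.
rewrite exprMn -exprM [leLHS](_ : _ =
  (4 ^+ q * (16^-1) ^+ (q * 2)) * (s ^+ 2 / 8)); last first.
  by field.
rewrite ler_wpM2r ?divr_ge0 ?sqr_ge0// mulnC exprM -exprMn.
by apply: lerXn2r; rewrite ?nnegrE; lra.
Qed.

End real_inequalities.

Section borel.
Context {R : realType}.

Lemma continuous_borel (T : ptopologicalType) (f : T -> R) :
  continuous f -> measurable_fun [set: borel_type T] (f : borel_type T -> R).
Proof.
move=> /continuousP cf; apply: (measurability _
  (measurable_realfun.RGenOpens.measurableE R)).
move=> _ [_ [a [b ->] <-]]; rewrite setTI; apply: sub_sigma_algebra.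
exact/cf/interval_open.
Qed.

Lemma norm2_ge0 p (v : 'rV[R]_p) : 0 <= norm2 v.
Proof. exact: sqrtr_ge0. Qed.

Lemma norm2Z p (t : R) (v : 'rV[R]_p) : 0 <= t -> norm2 (t *: v) = t * norm2 v.
Proof.
move=> t0; rewrite /norm2 -{2}(ger0_norm t0) -sqrtr_sqr -sqrtrM ?sqr_ge0//.
congr Num.sqrt; rewrite /sqnorm2 mulr_sumr; apply: eq_bigr => k _.
by rewrite mxE exprMn.
Qed.

Lemma norm2_continuous (T : topologicalType) p (g : T -> 'rV[R]_p) :
  (forall k, continuous (fun x => g x 0 k)) ->
    continuous (fun x => norm2 (g x)).
Proof.
move=> cg x; apply: (continuous_comp (f := fun x => sqnorm2 (g x)));
  last exact: sqrt_continuous.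
suff : {for x, continuous (fun x => \sum_(k < p) g x 0 k ^+ 2)} by [].
apply: continuous_sum_at => k _.
apply: (continuous_comp (f := fun x => g x 0 k) (g := fun s : R => s ^+ 2));
  first exact: cg.
exact: exprn_continuous.
Qed.

End borel.

(** * From the Fourier transform to the moment of order 1/2 *)

Section moment.
Context {R : realType} {d : nat} {X : ptopologicalType}.
Variables (M : smooth_atlas R d X) (p : nat).
Implicit Types g : test M p.

Lemma test_coord_sfun g k : sfun M (fun x => g x 0 k).
Proof. by move=> i; have /asboolP[sg _] := valP g; exact: sg. Qed.

Lemma test_norm2_continuous g : continuous (fun x => norm2 (g x)).
Proof.
by apply: norm2_continuous => k; apply: sfun_continuous; exact: test_coord_sfun.
Qed.

Lemma pairing_continuous g : continuous (fun xi : dist M p => pairing xi g).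
Proof.
have cp : continuous (fun (xi : dist M p) => (pairing xi : {ptws test M p ->
  R})).
  exact: initial_continuous.
move=> xi; apply: (continuous_comp (f := fun xi : dist M p =>
  (pairing xi : {ptws test M p -> R})) (g := fun h => h g)); first exact: cp.
exact: (@proj_continuous _ (fun=> R) g).
Qed.

Lemma measurable_pairing g (f : R -> R) : measurable_fun setT f ->
  measurable_fun [set: borel_type (dist M p)] (fun xi => f (pairing xi g)).
Proof.
move=> mf; apply: measurableT_comp => //; apply: continuous_borel.
exact: pairing_continuous.
Qed.

Lemma measurable_sqrt_pairing g :
  measurable_fun [set: borel_type (dist M p)] (fun xi => Num.sqrt `|pairing xi
    g|).
Proof.
apply: (measurable_pairing g (f := fun y => Num.sqrt `|y|)).
apply: continuous_measurable_fun => y.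
apply: (continuous_comp (f := fun y : R => `|y|)); last exact: sqrt_continuous.
exact: norm_continuous.
Qed.

Lemma measurable_test_norm2 g (f : R -> R) : measurable_fun setT f ->
  measurable_fun [set: borel_type X] (fun x => f (norm2 (g x))).
Proof.
move=> mf; apply: (measurableT_comp (g :=
  fun x : borel_type X => norm2 (g x))) => //.
by apply: continuous_borel; exact: test_norm2_continuous.
Qed.

Lemma pairingZ (xi : dist M p) t g : pairing xi (t *: g) = t * pairing xi g.
Proof. by rewrite /pairing linearZ. Qed.

Variables (m : {finite_measure set (borel_type X) -> \bar R})
  (mu : probability (borel_type (dist M p)) R).
Hypothesis mu_fourier : forall g, fourier mu g =
  (expR (- (1 / 2) * \int[m]_x ln (1 + 1 / 4 * norm2 (g x) ^+ 2)))%:C%C.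

Let L (t : R) g x := ln (1 + 1 / 4 * (t * norm2 (g x)) ^+ 2).

Lemma measurable_lnsq t : measurable_fun setT (fun s : R => ln (1 +
  1 / 4 * (t * s) ^+ 2)).
Proof.
apply: (measurableT_comp (@measurable_realfun.measurable_ln R)).
apply: continuous_measurable_fun => s; apply: cvgD; first exact: cvg_cst.
apply: cvgMl_tmp.
apply: (continuous_comp (f := fun s : R => t * s) (g := fun u : R => u ^+ 2)).
  by apply: cvgMl_tmp; exact: cvg_id.
exact: exprn_continuous.
Qed.

Lemma lnsq_ge0 (s : R) : 0 <= ln (1 + 1 / 4 * s ^+ 2).
Proof. by rewrite ln_ge0// lerDl mulr_ge0// sqr_ge0. Qed.

Lemma measurable_L t g : measurable_fun [set: borel_type X] (L t g).
Proof. exact: (measurable_test_norm2 g (measurable_lnsq t)). Qed.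

Lemma integrable_L t g : m.-integrable setT (EFin \o L t g).
Proof.
apply: measurable_bounded_integrable => //.
- exact: fin_num_fun_lty.
- exact: measurable_L.
have /asboolP[_ [C gC]] := valP g.
exists (1 / 4 * (t * C) ^+ 2); split; first exact: num_real.
move=> N CN x _; apply/ltW/(le_lt_trans _ CN).
rewrite /= ger0_norm ?lnsq_ge0//; apply: le_trans (le_ln1Dx _) _.
  by apply: (@lt_le_trans _ _ 0); [rewrite ltrN10|rewrite mulr_ge0// sqr_ge0].
rewrite ler_wpM2l// !exprMn ler_wpM2l ?sqr_ge0//.
by apply: lerXn2r; rewrite ?nnegrE ?norm2_ge0//;
  [exact: le_trans (norm2_ge0 _) (gC x)|exact: gC].
Qed.

Lemma integrable_cos_pairing g t :
  mu.-integrable setT (EFin \o (fun xi => cos (t * pairing xi g))).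
Proof.
apply: measurable_bounded_integrable => //.
- by rewrite (le_lt_trans (probability_le1 _ _))// ltry.
- apply: (measurable_pairing g (f := fun y => cos (t * y))).
  apply: continuous_measurable_fun => s;
    apply: (continuous_comp (f := fun s : R => t * s) (g := cos)).
    by apply: cvgMl_tmp; exact: cvg_id.
  exact: continuous_cos.
exists 1; split; first exact: num_real.
by move=> N N1 xi _; apply/ltW/(le_lt_trans _ N1); exact: cos_max.
Qed.

(** The real part of the Fourier transform at [t *: g] is [e^(-u)] with [u] the right-hand side, and
    [1 - e^(-u) <= u]. *)
Lemma one_minus_cos_le g t : 0 <= t ->
  (\int[mu]_xi (1 - cos (t * pairing xi g))%:E <=
   \int[m]_x (1 / 2 * L t g x)%:E)%E.
Proof.
move=> t0.
have := congr1 (@complex.Re R) (mu_fourier (t *: g)) => /=.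
under eq_Rintegral do rewrite pairingZ.
have nZ x : norm2 ((t *: g) x) = t * norm2 (g x) by exact: norm2Z.
under [in RHS]eq_Rintegral do rewrite nZ.
move=> E.
have icst : mu.-integrable setT (EFin \o cst (1 : R)).
  apply: measurable_bounded_integrable => //.
    by rewrite (le_lt_trans (probability_le1 _ _))// ltry.
  by exists 1; split=> // N N1 xi _; rewrite /= normr1 ltW.
have icos := integrable_cos_pairing g t.
have I1 : (\int[mu]_xi (1 : R)%:E = 1)%E.
  transitivity (1 * mu setT)%E; first exact: integral_cst.
  by rewrite probability_setT mule1.
have -> : (\int[mu]_xi (1 - cos (t * pairing xi g))%:E =
    (1 - \int[mu]_xi (cos (t * pairing xi g)))%:E)%E.
  under eq_integral do rewrite EFinB.
  rewrite (integralB_EFin _ icst icos)// EFinB /Rintegral fineK.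
    by rewrite I1.
  exact: integrable_fin_num.
rewrite E.
have -> : (\int[m]_x (1 / 2 * L t g x)%:E = (1 / 2 * \int[m]_x L t g x)%:E)%E.
  under eq_integral do rewrite EFinM.
  rewrite integralZl//; last exact: integrable_L.
  by rewrite [in RHS]EFinM /Rintegral fineK//; apply: integrable_fin_num => //;
    exact: integrable_L.
rewrite lee_fin lerBlDl -lerBlDr mulNr.
exact: expR_ge1Dx.
Qed.

(** The scales [16^q] and [16^-q] are paired so that the sum runs over natural numbers; the scale 1
    is counted twice, which is harmless in an upper bound. *)
Let G (q : nat) (y : R) : R :=
  (4^-1) ^+ q * (1 - cos (16 ^+ q * y)) + 4 ^+ q * (1 - cos ((16^-1) ^+ q * y)).

Lemma one_minus_cos_ge0 (y : R) : 0 <= 1 - cos y.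
Proof. by rewrite subr_ge0 cos_le1. Qed.

Let G_ge0 q y : 0 <= G q y.
Proof.
by apply: addr_ge0; apply: mulr_ge0; rewrite ?exprn_ge0 ?one_minus_cos_ge0.
Qed.

Let mcos (c t : R) :
  measurable_fun setT (fun y : R => c * (1 - cos (t * y))).
Proof.
apply: continuous_measurable_fun => s; apply: cvgMl_tmp; apply: cvgB.
  exact: cvg_cst.
apply: (continuous_comp (f := fun s : R => t * s) (g := cos)).
  by apply: cvgMl_tmp; exact: cvg_id.
exact: continuous_cos.
Qed.

Lemma int_one_minus_cos g (c t : R) : 0 <= c -> 0 <= t ->
  (\int[mu]_xi (c * (1 - cos (t * pairing xi g)))%:E <=
   \int[m]_x (c * (1 / 2 * L t g x))%:E)%E.
Proof.
move=> c0 t0.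
under eq_integral do rewrite EFinM.
under [in leRHS]eq_integral do rewrite EFinM.
rewrite ge0_integralZl; [|exact: measurableT| |by []|by []]; last first.
  apply/measurable_EFinP; have := measurable_pairing g (mcos 1 t).
  by under eq_fun do rewrite mul1r.
rewrite ge0_integralZl; [|exact: measurableT| | |by []]; last 2 first.
- apply/measurable_EFinP; apply: measurable_funM => //; exact: measurable_L.
- by move=> x _; rewrite lee_fin mulr_ge0// lnsq_ge0.
by apply: lee_wpmul2l; [rewrite lee_fin|exact: one_minus_cos_le].
Qed.

Let IH g := (\int[m]_x (Hfun (norm2 (g x)))%:E)%E.

Lemma measurable_Hfun g : measurable_fun [set: borel_type X] (fun x => Hfun
  (norm2 (g x))).
Proof.
apply: measurable_test_norm2; apply: continuous_measurable_fun.
exact: continuous_Hfun.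
Qed.

Let int_G q g : (\int[mu]_xi (G q (pairing xi g))%:E <=
  ((2^-1) ^+ q)%:E * IH g)%E.
Proof.
rewrite /G; under eq_integral do rewrite EFinD.
have mc c t : measurable_fun [set: borel_type (dist M p)]
    (fun xi => (c * (1 - cos (t * pairing xi g)))%:E).
  by apply/measurable_EFinP; exact: (measurable_pairing g (mcos c t)).
have c0 (c t : R) xi : 0 <= c -> (0 <= (c * (1 - cos (t * pairing xi g)))%:E)%E.
  by move=> c_ge0; rewrite lee_fin mulr_ge0 ?one_minus_cos_ge0.
rewrite ge0_integralD; [|exact: measurableT|by move=> xi _; apply: c0;
  rewrite exprn_ge0
  |exact: mc|by move=> xi _; apply: c0; rewrite exprn_ge0|exact: mc].
apply: (@le_trans _ _ (\int[m]_x ((4^-1) ^+ q * (1 / 2 * L (16 ^+ q) g x))%:E +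
   \int[m]_x (4 ^+ q * (1 / 2 * L ((16^-1) ^+ q) g x))%:E)%E).
  by apply: leeD; apply: int_one_minus_cos; rewrite exprn_ge0.
have mL c t : measurable_fun [set: borel_type X] (fun x => (c * (1 / 2 * L t g
  x))%:E).
  apply/measurable_EFinP; do 2 (apply: measurable_funM => //);
    exact: measurable_L.
have L0 (c t : R) x : 0 <= c -> (0 <= (c * (1 / 2 * L t g x))%:E)%E.
  by move=> c_ge0; rewrite lee_fin !mulr_ge0 ?lnsq_ge0.
rewrite -ge0_integralD; [|exact: measurableT|by move=> x _; apply: L0;
  rewrite exprn_ge0
  |exact: mL|by move=> x _; apply: L0; rewrite exprn_ge0|exact: mL].
have mH : measurable_fun [set: borel_type X] (fun x => (Hfun (norm2 (g x)))%:E).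
  by apply/measurable_EFinP; exact: measurable_Hfun.
have H0 x : (0 <= (Hfun (norm2 (g x)))%:E)%E by rewrite lee_fin Hfun_ge0.
have q0 : (0 <= ((2^-1 : R) ^+ q)%:E)%E by rewrite lee_fin exprn_ge0.
rewrite /IH -ge0_integralZl;
  [|exact: measurableT|exact: mH|by move=> x _|exact: q0].
apply: ge0_le_integral; [exact: measurableT| | | |].
- by move=> x _; apply: adde_ge0; apply: L0; rewrite exprn_ge0.
- by apply: emeasurable_funD; exact: mL.
- exact: measurable_funeM.
- move=> x _; rewrite -EFinD -EFinM lee_fin; apply: ln1D_weighted.
  exact: norm2_ge0.
Qed.

Let sum_int_G g :
  (\sum_(0 <= q <oo) \int[mu]_xi (G q (pairing xi g))%:E <= 2%:E * IH g)%E.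
Proof.
have IH0 : (0 <= IH g)%E.
  by apply: integral_ge0 => x _; rewrite lee_fin Hfun_ge0.
apply: lime_le.
  by apply: is_cvg_nneseries => q _ _; apply: integral_ge0 => xi _;
    rewrite lee_fin.
apply: nearW => n.
apply: (@le_trans _ _ (\sum_(0 <= q < n) ((2^-1) ^+ q)%:E * IH g)%E).
  by apply: lee_sum => q _; exact: int_G.
rewrite -ge0_sume_distrl; last by move=> q _; rewrite lee_fin exprn_ge0.
apply: lee_wpmul2r => //; rewrite sumEFin lee_fin.
exact: sum_half_le.
Qed.

Let G_norm q y : G q `|y| = G q y.
Proof.
have E (c : R) : 0 <= c -> cos (c * `|y|) = cos (c * y).
  by move=> c0; rewrite -{1}(ger0_norm c0) -normrM cos_norm.
by rewrite /G !E ?exprn_ge0// invr_ge0.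
Qed.

Lemma sqrt_moment : exists2 C : R, 0 <= C & forall g : test M p,
  (\int[mu]_xi (Num.sqrt `|pairing xi g|)%:E <=
   C%:E * \int[m]_x (Hfun (norm2 (g x)))%:E)%E.
Proof.
pose kappa : R := 1 - cos (8^-1).
have kappa0 : 0 < kappa.
  have e8 : 0 < (8^-1 : R) by rewrite invr_gt0.
  have e8' : 8^-1 <= (1 : R) by rewrite invf_le1// ler1n.
  rewrite subr_gt0 -[ltRHS]cos0 ltr_cos ?in_itv/= ?lexx ?pi_ge0//.
  by rewrite ltW//= (le_trans e8')// (le_trans _ (pi_ge2 R))// ler1n.
(* One factor 2 comes from [sqrt_le_cos], the other from the sum of the powers of 1/2. *)
exists (4 / kappa); first by rewrite divr_ge0// ltW.
move=> g.
have pw xi : ((kappa * Num.sqrt `|pairing xi g|)%:E <=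
    2%:E * \sum_(0 <= q <oo) (G q (pairing xi g))%:E)%E.
  have S0 : (0 <= \sum_(0 <= q <oo) (G q (pairing xi g))%:E)%E.
    by apply: nneseries_ge0 => q _ _; rewrite lee_fin.
  (* No scaling brings 0 into the window of [sqrt_le_cos], but then the left side vanishes. *)
  have [yE|y0] := eqVneq (pairing xi g) 0.
    by rewrite {1}yE normr0 sqrtr0 mulr0; apply: mule_ge0; [by []|exact: S0].
  have [|q qP] := @sqrt_le_cos R `|pairing xi g|; first by rewrite normr_gt0.
  apply: le_trans (_ : (2 * G q `|pairing xi g|)%:E <= _)%E;
    first by rewrite lee_fin.
  rewrite G_norm EFinM; apply: lee_wpmul2l => //.
  apply: (@le_trans _ _ (\sum_(0 <= k < q.+1) (G k (pairing xi g))%:E)%E).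
    by rewrite big_nat_recr//= leeDr// sume_ge0// => k _; rewrite lee_fin.
  by apply: nneseries_lim_ge => k _ _; rewrite lee_fin.
have mG q : measurable_fun [set: borel_type (dist M p)]
    (fun xi => (G q (pairing xi g))%:E).
  apply/measurable_EFinP; apply: measurable_pairing.
  by apply: measurable_funD; exact: mcos.
have msq : measurable_fun [set: borel_type (dist M p)]
    (fun xi => (Num.sqrt `|pairing xi g|)%:E).
  by apply/measurable_EFinP; exact: measurable_sqrt_pairing.
have sq0 xi : (0 <= (Num.sqrt `|pairing xi g|)%:E)%E
  by rewrite lee_fin sqrtr_ge0.
have : (kappa%:E * \int[mu]_xi (Num.sqrt `|pairing xi g|)%:E <= 4%:E * IH g)%E.
  rewrite -ge0_integralZl; [|exact: measurableT|exact: msq|by move=> xi _|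
    by rewrite lee_fin ltW].
  apply: (@le_trans _ _ (\int[mu]_xi (2%:E * \sum_(0 <=
    q <oo) (G q (pairing xi g))%:E))%E).
    apply: ge0_le_integral; [exact: measurableT| | | |].
    - by move=> xi _; apply: mule_ge0 => //; rewrite lee_fin ltW.
    - exact: measurable_funeM.
    - apply: measurable_funeM; apply: ge0_emeasurable_sum => // q xi _ _.
      by rewrite lee_fin.
    - by move=> xi _; rewrite -EFinM; exact: pw.
  rewrite ge0_integralZl//; last 2 first.
  - apply: ge0_emeasurable_sum => // q xi _ _; by rewrite lee_fin.
  - by move=> xi _; apply: nneseries_ge0 => q _ _; rewrite lee_fin.
  rewrite integral_nneseries//; last by move=> q xi _; rewrite lee_fin.
  apply: le_trans (lee_wpmul2l _ (sum_int_G g)) _ => //.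
  by rewrite muleA -EFinM (_ : 2 * 2 = 4 :> R)//; ring.
move=> H.
have k0 : (0 <= (kappa^-1)%:E)%E by rewrite lee_fin invr_ge0 ltW.
have := lee_wpmul2l k0 H.
rewrite !muleA -!EFinM mulVf ?gt_eqF// mul1e.
by rewrite [in X in _ -> X]mulrC.
Qed.

End moment.

(** * Approximation by cells *)

Section finite_borel_measure.
Context {R : realType} {X : ptopologicalType}.
Variable m : {finite_measure set (borel_type X) -> \bar R}.

(** Dominated convergence carries a strict bound for the limit over to the terms near infinity. It
    serves to estimate integrals of smooth approximations through those of cell indicators, with [h]
    an explicit majorant of the limit. *)
Lemma dominated_le (f : nat -> X -> R) (F : X -> R) (h : X -> \bar R) (B : R)
    (c : \bar R) :
  (forall q, measurable_fun [set: borel_type X] (f q)) ->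
  (forall q y, 0 <= f q y <= B) ->
  (forall y, f q y @[q --> \oo] --> F y) ->
  measurable_fun [set: borel_type X] h -> (forall y, ((F y)%:E <= h y)%E) ->
  (\int[m]_y h y < c)%E ->
  \forall q \near \oo, (\int[m]_y (f q y)%:E <= c)%E.
Proof.
move=> mf f0B fF mh Fh hc.
have mEf q : measurable_fun [set: borel_type X] (EFin \o f q)
  by exact/measurable_EFinP.
have EfF (y : borel_type X) : setT y ->
  (EFin \o f q) y @[q --> \oo] --> (EFin \o F) y.
  by move=> _; apply/fine_cvgP; split; [exact: nearW|exact: fF].
have F0 y : 0 <= F y.
  rewrite -(cvg_lim _ (fF y))//; apply: limr_ge.
    by apply/cvg_ex; exists (F y); exact: fF.
  by apply: nearW => q; have /andP[] := f0B q y.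
have B0 : 0 <= B by have /andP[] := f0B 0%N point; exact: le_trans.
have intF : (\int[m]_y (EFin \o f q) y @[q --> \oo] --> \int[m]_y (EFin \o F)
  y)%E.
  apply: (@dominated_cvg _ _ _ _ setT measurableT _ _ (EFin \o cst B)) => //.
  - apply: measurable_bounded_integrable => //; first exact: fin_num_fun_lty.
    exists B; split; first exact: num_real.
    by move=> N BN y _; rewrite /= ger0_norm// ltW.
  - by move=> q y _; have /andP[? ?] := f0B q y; rewrite /= lee_fin ger0_norm.
have mF := emeasurable_fun_cvg _ _ mEf EfF.
have Fc : (\int[m]_y (EFin \o F) y < c)%E.
  apply: le_lt_trans hc; apply: ge0_le_integral; [by []| |exact: mF|exact: mh|].
  - by move=> y _; rewrite lee_fin.
  - by move=> y _; exact: Fh.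
have [N _ NF] := intF [set y | (y < c)%E]
  (open_nbhs_nbhs (conj (@open_ereal_lt_ereal _ _) Fc)).
by exists N => // q /NF /= /ltW.
Qed.

Variable U : nat -> set X.
Hypothesis oU : forall n, open (U n).
Hypothesis coverU : forall x, exists n, U n x.

Definition rest (J : nat) : set (borel_type X) := ~` \bigcup_(n in `I_J) U n.

Lemma measurable_open (A : set X) : open A ->
  measurable (A : set (borel_type X)).
Proof. by move=> oA; exact: sub_sigma_algebra. Qed.

Lemma measurable_rest J : measurable (rest J).
Proof.
by apply: measurableC; apply: measurable_open; apply: bigcup_open => n _.
Qed.

Lemma rest_small (e : R) : 0 < e -> \forall J \near \oo, (m (rest J) <= e%:E)%E.
Proof.
move=> e0.
have R0 : \bigcap_J rest J = set0.
  apply/seteqP; split=> // x xR; have [n Unx] := coverU x.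
  by have := xR n.+1 I; apply; exists n => /=.
have m0 : (m (rest 0) < +oo)%E.
  by rewrite ltey_eq fin_num_measure//; exact: measurable_rest.
have mcap : measurable (\bigcap_J rest J) by rewrite R0; exact: measurable0.
have homo : {homo rest : J J' / (J <= J')%N >-> (J' <= J)%O}.
  move=> J J' JJ'; apply/subsetPset => x xR [n nJ Unx]; apply: xR.
  by exists n => //; exact: leq_trans JJ'.
have := nonincreasing_cvg_mu m0 measurable_rest mcap homo.
rewrite R0 measure0 => mR.
have e0' : (0 < e%:E)%E by rewrite lte_fin.
have [N _ NJ] := mR [set y | (y < e%:E)%E]
  (open_nbhs_nbhs (conj (@open_ereal_lt_ereal _ _) e0')).
by exists N => // J /NJ /= /ltW.
Qed.

Variable K : nat -> set X.
Hypothesis UK : forall n, U n `<=` K n.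
Hypothesis cK : forall n, compact (K n).

(** [W x] is the first [k] such that [x] has left the remainder [rest (l k)], of measure at most
    [2^-k], and [V x] counts all [k] for which [x] is in the remainder. So [V] dominates [W], is
    measurable by construction, and has integral at most the sum of the [2^-k]. *)
Lemma integrable_weight : exists (W : X -> nat) (V : borel_type X -> \bar R),
  [/\ forall r, exists2 C : set X, compact C & forall x, (W x <= r)%N -> C x,
     measurable_fun setT V, forall x, (0 <= V x)%E,
     forall x, ((W x)%:R%:E <= V x)%E & (\int[m]_x V x <= 2%:E)%E].
Proof.
(* The condition [k <= J] makes [W] finite: a point of [U n] is outside [rest (l n.+1)]. *)
have : forall k, exists J : nat,
  (k <= J)%N /\ (m (rest J) <= ((2^-1) ^+ k)%:E)%E.
  move=> k; have e0 : 0 < (2^-1 : R) ^+ k by rewrite exprn_gt0.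
  have [N _ NJ] := rest_small e0; exists (maxn k N); split;
    first exact: leq_maxl.
  by apply: NJ => /=; exact: leq_maxr.
move=> /choice[l lP].
have : forall x, exists w : nat, ~ rest (l w) x /\ forall k, (k < w)%N ->
  rest (l k) x.
  move=> x; have [n Unx] := coverU x.
  have Pn : `[< ~ rest (l n.+1) x >].
    apply/asboolP; apply; exists n => //=; apply: leq_trans (lP n.+1).1.
    by [].
  have [w /asboolP wP wmin] :=
    ex_minnP (ex_intro (fun w => `[< ~ rest (l w) x >]) _ Pn).
  exists w; split => // k kw; apply: contrapT => kx.
  by have := wmin k; rewrite leqNgt kw => /(_ (asboolT kx)).
move=> /choice[W WP].
pose V (x : borel_type X) : \bar R :=
  (\sum_(0 <= k <oo) (\1_(rest (l k)) x)%:E)%E.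
have V0 (k : nat) (x : borel_type X) : (0 <= (\1_(rest (l k)) x : R)%:E)%E.
  by rewrite lee_fin.
have mI (k : nat) : measurable_fun setT (fun x : borel_type X => (\1_(rest (l
  k)) x : R)%:E).
  by apply/measurable_EFinP; apply: measurable_indic; exact: measurable_rest.
exists W, V; split.
- move=> r; exists (\big[setU/set0]_(k < r.+1) \big[setU/set0]_(n < l k) K n).
    by apply: bigsetU_compact => k _; apply: bigsetU_compact.
  move=> x Wr; have [/contrapT[n nl Unx] _] := WP x.
  rewrite -(bigcup_mkord _ (fun k => \big[setU/set0]_(n < l k) K n)).
  exists (W x) => //=; rewrite -bigcup_mkord.
  by exists n => //; exact: UK.
- by apply: ge0_emeasurable_sum => // k x _ _.
- by move=> x; apply: nneseries_ge0.
- move=> x; apply: (@le_trans _ _ (\sum_(0 <=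
    k < W x) (\1_(rest (l k)) x)%:E)%E).
    rewrite (eq_big_nat _ _ (F2 := fun=> (1 : R)%:E)).
      by rewrite sumEFin sumr_const_nat subn0.
    by move=> k /andP[_ kW]; rewrite indicE mem_set//; exact: (WP x).2.
  exact: nneseries_lim_ge.
- rewrite integral_nneseries//; apply: lime_le.
    by apply: is_cvg_nneseries => k _ _; apply: integral_ge0.
  apply: nearW => n.
  apply: (@le_trans _ _ (\sum_(0 <= k < n) ((2^-1) ^+ k)%:E)%E).
    apply: lee_sum => k _; rewrite integral_indic//;
      last exact: measurable_rest.
    by rewrite setIT; exact: (lP k).2.
  rewrite sumEFin lee_fin.
  exact: sum_half_le.
Qed.

End finite_borel_measure.

(** * Cells and their smooth indicators *)

Section cells.
Context {R : realType} {X : Type}.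
Variable b : nat -> X -> R.
Hypothesis b01 : forall n x, 0 <= b n x <= 1.

(* [cellf q n] is a smooth approximation, as q grows, of the indicator of the
   cell of the points where [b n] is the first nonvanishing function. *)
Definition cell n : set X :=
  [set x | 0 < b n x /\ forall i, (i < n)%N -> b i x = 0].

Definition cellf (q n : nat) (x : X) : R :=
  (1 - (1 - b n x) ^+ q) * \prod_(i < n) (1 - b i x) ^+ q.

Definition cell_ind n x : R := if `[< cell n x >] then 1 else 0.

Let onemb01 n x : 0 <= 1 - b n x <= 1.
Proof. by have /andP[b0 b1] := b01 n x; rewrite subr_ge0 b1 gerBl. Qed.

Lemma cellf01 q n x : 0 <= cellf q n x <= 1.
Proof.
have H i : 0 <= (1 - b i x) ^+ q <= 1.
  by have /andP[b0 b1] := onemb01 i x; rewrite exprn_ge0// exprn_ile1.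
have /andP[h0 h1] : 0 <= \prod_(i < n) (1 - b i x) ^+ q <= 1.
  rewrite prodr_ge0 => [|i _]; last by have /andP[] := H i.
  by apply: prodr_ile1 => i _; exact: H.
have /andP[k0 k1] := H n.
have k0' : 0 <= 1 - (1 - b n x) ^+ q by rewrite subr_ge0.
by rewrite /cellf mulr_ge0//= mulr_ile1// gerBl.
Qed.

(** The powers [(1 - b i x)^q] tend to 1 where [b i x = 0] and to 0 where [b i x > 0]; the product
    of the limits is the indicator. *)
Lemma cellf_cvg n x : cellf q n x @[q --> \oo] --> cell_ind n x.
Proof.
pose z i : R := if b i x == 0 then 1 else 0.
have cz i : (1 - b i x) ^+ q @[q --> \oo] --> z i.
  rewrite /z; case: eqVneq => [->|b0].
    by under eq_fun do rewrite subr0 expr1n; exact: cvg_cst.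
  apply: cvg_expr; have /andP[h0 h1] := onemb01 i x.
  rewrite ger0_norm// gtrBl lt_neqAle eq_sym b0.
  by have /andP[] := b01 i x.
have -> : cell_ind n x = (1 - z n) * \prod_(i < n) z i.
  rewrite /cell_ind; case: asboolP => [[bn bi]|ncell].
    rewrite {1}/z gt_eqF// subr0 mul1r big1// => i _.
    by rewrite /z bi// eqxx.
  rewrite {1}/z; case: eqVneq => [_|bn]; first by rewrite subrr mul0r.
  have [i /negP bi] : exists i : 'I_n, ~ (b i x == 0).
    apply/existsNP => bi; apply: ncell; split=> [|i ni].
      by rewrite lt_neqAle eq_sym bn; have /andP[] := b01 n x.
    by apply/eqP; exact: (bi (Ordinal ni)).
  have zi : z i = 0 by rewrite /z (negbTE bi).
  by rewrite (bigD1 i)//= zi mul0r mulr0.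
apply: cvgM; first by apply: cvgB => //; exact: cvg_cst.
apply: cvg_big => [|i _]; last exact: cz.
exact: mul_continuous.
Qed.

(** A point lies only in the cell of its first nonvanishing [b n], so at most one term survives,
    whatever the coefficients. *)
Lemma cell_ind_sum J x :
  (exists n0, [/\ (n0 < J)%N, cell n0 x &
    forall a : nat -> R, \sum_(n < J) a n * cell_ind n x = a n0]) \/
  ((forall n, (n < J)%N -> b n x = 0) /\
    forall a : nat -> R, \sum_(n < J) a n * cell_ind n x = 0).
Proof.
have [[n [nJ bn]]|H] := pselect (exists n, (n < J)%N /\ 0 < b n x); last first.
  right; have b0 n : (n < J)%N -> b n x = 0.
    move=> nJ; apply/eqP; apply: contrapT => /negP bn; apply: H; exists n.
    by split=> //; rewrite lt_neqAle eq_sym bn; have /andP[] := b01 n x.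
  split=> // a; rewrite big1// => n _;
    rewrite /cell_ind asboolF ?mulr0// => -[].
  by rewrite b0// ltxx.
left; have [n0 bn0 nmin] := ex_minnP (ex_intro (fun n => 0 < b n x) n bn).
have n0J : (n0 < J)%N by apply: leq_ltn_trans nJ; exact: nmin.
have cn0 : cell n0 x.
  split=> // i i0; apply/eqP; apply: contrapT => /negP bi.
  have := nmin i; rewrite lt_neqAle eq_sym bi.
  have /andP[-> _] := b01 i x.
  by move=> /(_ isT); rewrite leqNgt i0.
exists n0; split=> // a; rewrite (bigD1 (Ordinal n0J))//= big1 ?addr0.
  by rewrite /cell_ind asboolT// mulr1.
move=> k kn0; rewrite /cell_ind asboolF ?mulr0// => -[bk ik].
have : (n0 <= k)%N by exact: nmin.
rewrite leq_eqVlt => /predU1P[E|/ik b0]; last by move: bn0; rewrite b0 ltxx.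
by move: kn0; rewrite -val_eqE/= E eqxx.
Qed.

(** [W] has natural values, so it attains its minimum on a nonempty cell. Sampling there lets the
    weight of a cell be bounded by [V] at every one of its points; an empty cell gets the default
    [x0]. *)
Lemma cell_min_point (W : X -> nat) (x0 : X) : exists x : nat -> X, forall n y,
  cell n y -> cell n (x n) /\ (W (x n) <= W y)%N.
Proof.
have : forall n, exists x, forall y, cell n y -> cell n x /\ (W x <= W y)%N.
  move=> n; have [[y cy]|nc] := pselect (exists y, cell n y); last first.
    by exists x0 => y cy; exfalso; apply: nc; exists y.
  have Py : `[< exists2 y', cell n y' & W y' = W y >] by apply/asboolP;
    exists y.
  have [w /asboolP[x cx Wx] wmin] :=
    ex_minnP (ex_intro (fun w => `[< exists2 y', cell n y' & W y' = w >]) _ Py).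
  exists x => y' cy'; split=> //; rewrite Wx; apply: wmin.
  by apply/asboolP; exists y'.
by move=> /choice[x xP]; exists x.
Qed.

End cells.

Section approximation.
Context {R : realType} {d : nat} {X : ptopologicalType}.
Variables (M : smooth_atlas R d X) (p : nat).
Hypotheses (hX : hausdorff_space X) (scX : @second_countable X).
Variable m : {finite_measure set (borel_type X) -> \bar R}.
Variables (W : X -> nat) (V : borel_type X -> \bar R).
Hypotheses (mV : measurable_fun setT V) (V0 : forall x, (0 <= V x)%E)
  (WV : forall x, ((W x)%:R%:E <= V x)%E) (intV : (\int[m]_x V x <= 2%:E)%E).

Lemma bump_test (phi : X -> R) (c : 'I_p) : sfun M phi ->
  (forall x, 0 <= phi x <= 1) ->
  exists T : test M p, forall x, T x = phi x *: delta_mx 0 c :> 'rV[R]_p.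
Proof.
move=> sphi phi01; have [||T TE] :=
  @test_of _ _ _ M p (fun x => phi x *: delta_mx 0 c).
- move=> k; rewrite (_ : (fun _ => _) =
    phi \* (fun=> (delta_mx 0 c : 'rV[R]_p) 0 k)).
    by apply: sfunM; [exact: sphi|exact: sfun_cst].
  by apply/funext => x; rewrite mxE.
- exists 1 => x k; rewrite !mxE eqxx/=; have /andP[h0 h1] := phi01 x.
  rewrite normrM (ger0_norm h0) mulr_ile1// ?normr_ge0//.
  by case: (k == c); rewrite ?normr1 ?normr0.
by exists T => x; rewrite TE.
Qed.

Lemma norm2_delta (c : 'I_p) (s : R) : 0 <= s ->
  norm2 (s *: delta_mx 0 c : 'rV[R]_p) = s.
Proof.
move=> s0; rewrite norm2Z// /norm2 /sqnorm2 (bigD1 c)//= big1 => [|k kc].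
  by rewrite addr0 mxE !eqxx expr1n sqrtr1 mulr1.
by rewrite mxE eqxx (negbTE kc) expr0n.
Qed.

Lemma cellf_sfun b q n : (forall n, sfun M (b n)) -> sfun M (cellf b q n).
Proof.
move=> sb; apply: sfunM; first by apply/sfun1B/sfunX/sfun1B.
by apply: sfun_prod => i; apply/sfunX/sfun1B.
Qed.

(** Each point has a bump supported where the first [N] functions stay within [e / 2] of their
    values at that point; second countability reduces these bumps to a sequence. *)
Lemma oscillation_cover (g_ : nat -> test M p) (N : nat) (e : R) : 0 < e ->
  exists b : nat -> X -> R, [/\ forall n, sfun M (b n),
    forall n x, 0 <= b n x <= 1, forall x, exists n, 0 < b n x &
    forall n k (c : 'I_p) x y, (k < N)%N -> 0 < b n x -> 0 < b n y ->
      `|g_ k x 0 c - g_ k y 0 c| <= e].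
Proof.
move=> e0.
pose good (b : X -> R) (B : set X) := [/\ sfun M b, forall x, 0 <= b x <= 1,
  B = [set x | 0 < b x] & forall k (c : 'I_p) x y, (k < N)%N -> B x -> B y ->
      `|g_ k x 0 c - g_ k y 0 c| <= e].
have [x|b [B [bB coverB]]] := @lindelof_cover X (X -> R) good scX.
  have e2 : 0 < e / 2 by rewrite divr_gt0.
  have nearx : \forall z \near x, forall (k : 'I_N) (c : 'I_p),
      `|g_ k x 0 c - g_ k z 0 c| <= e / 2.
    apply: filter_forall => k; apply: filter_forall => c.
    have cg : {for x, continuous (fun z => g_ k z 0 c)}.
      exact: (sfun_continuous (test_coord_sfun (g_ k) c)).
    by move/cvgrPdist_le/(_ _ e2) : cg.
  pose A := [set z | forall (k : 'I_N) (c : 'I_p),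
    `|g_ k x 0 c - g_ k z 0 c| <= e / 2].
  have [phi [sphi phi01 phix phi0]] :=
    sfun_bump M hX (@open_interior _ A) nearx.
  have phiA z : 0 < phi z -> A z.
    move=> phiz; apply: interior_subset; apply: contrapT => /phi0 E.
    by move: phiz; rewrite E ltxx.
  exists phi, [set z | 0 < phi z]; split=> //.
    by apply: open_positive; exact: sfun_continuous.
  split=> // k c y z kN /phiA Ay /phiA Az.
  rewrite [e]splitr -(subrKA (g_ k x 0 c)); apply: le_trans (ler_normD _ _) _.
  apply: lerD; last exact: (Az (Ordinal kN)).
  by rewrite distrC; exact: (Ay (Ordinal kN)).
exists b; split.
- by move=> n; have [_ []] := bB n.
- by move=> n; have [_ []] := bB n.
- by move=> x; have [n] := coverB x; have [_ [_ _ ->]] := bB n; exists n.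
- move=> n k c x y kN bx by_; have [_ [_ _ BE osc]] := bB n.
  by apply: osc => //; rewrite BE.
Qed.

End approximation.

(** * Approximation by cells with a bounded weighted mass *)

Section cell_approximation.
Context {R : realType} {d : nat} {X : ptopologicalType}.
Variables (M : smooth_atlas R d X) (p : nat).
Hypotheses (hX : hausdorff_space X) (scX : @second_countable X).
Variable m : {finite_measure set (borel_type X) -> \bar R}.
Variables (W : X -> nat) (V : borel_type X -> \bar R).
Hypotheses (mV : measurable_fun setT V) (V0 : forall x, (0 <= V x)%E)
  (WV : forall x, ((W x)%:R%:E <= V x)%E) (intV : (\int[m]_x V x <= 2%:E)%E).

Let mX : R := fine (m setT).

Let mXE : m setT = mX%:E.
Proof. by rewrite fineK// fin_num_measure. Qed.

Let mX0 : 0 <= mX.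
Proof. exact: fine_ge0. Qed.

Let int_cst (a : R) : (\int[m]_x a%:E = (a * mX)%:E)%E.
Proof.
transitivity (a%:E * m setT)%E; first exact: integral_cst.
by rewrite mXE EFinM.
Qed.

(** [2 + mX] bounds the integral of [V + 1], [p] counts the components, and the final 1 provides the
    strict inequality that [dominated_le] asks for. *)
Definition weighted_mass : R := p%:R * Hfun (1 : R) * (2 + mX) + 1.

Lemma Hfun_small (c e : R) : 0 < e -> exists2 t : R, 0 < t & Hfun (c * t) <= e.
Proof.
move=> e0.
have cH : Hfun (c * t) @[t --> (0 : R)] --> Hfun (c * 0).
  apply: (continuous_comp (f := fun t => c * t) (g := @Hfun R)).
    by apply: cvgMl_tmp; exact: cvg_id.
  exact: continuous_Hfun.
move: cH; rewrite mulr0 Hfun0 => /cvgrPdist_le/(_ _ e0)[r /= r0 rH].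
exists (r / 2); first by rewrite divr_gt0.
have := rH (r / 2); rewrite /= !sub0r !normrN (ger0_norm (Hfun_ge0 _)); apply.
by rewrite gtr0_norm ?divr_gt0// ltr_pdivrMr// ltr_pMr// ltr1n.
Qed.

Variables (g_ : nat -> test M p) (N : nat).

Lemma uniform_entry_bound : exists C : R, forall k x (c : 'I_p), (k < N)%N ->
  `|g_ k x 0 c| <= C.
Proof.
have : forall k, exists C : R, forall x, norm2 (g_ k x) <= C.
  by move=> k; have /asboolP[_] := valP (g_ k).
move=> /choice[C CP]; exists (\sum_(k < N) `|C k|) => k x c kN;
  apply: le_trans (normr_le_norm2 _ _) _.
apply: le_trans (CP k x) _; apply: le_trans (ler_norm _) _.
by rewrite (bigD1 (Ordinal kN))//= lerDl sumr_ge0.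
Qed.

Variable delta : R.
Hypothesis delta0 : 0 < delta.

Section limit_in_q.
Variables (b : nat -> X -> R) (xs : nat -> X) (J : nat) (e C : R).
Hypotheses (sb : forall n, sfun M (b n)) (b01 : forall n x, 0 <= b n x <= 1)
  (osc : forall n k (c : 'I_p) x y, (k < N)%N -> 0 < b n x -> 0 < b n y ->
      `|g_ k x 0 c - g_ k y 0 c| <= e)
  (xsP : forall n y, cell b n y -> cell b n (xs n) /\ (W (xs n) <= W y)%N)
  (gC : forall k x (c : 'I_p), (k < N)%N -> `|g_ k x 0 c| <= C).

Variable T : nat -> nat -> 'I_p -> test M p.
Hypothesis TE : forall q n c x,
  T q n c x = cellf b q n x *: delta_mx 0 c :> 'rV[R]_p.

Definition cell_sum q k : test M p :=
  \sum_(n < J) \sum_(c < p) g_ k (xs n) 0 c *: T q n c.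

Lemma test_sumE (I : Type) (r : seq I) (F : I -> test M p) x :
  test_val (\sum_(i <- r) F i) x = \sum_(i <- r) test_val (F i) x.
Proof.
elim: r => [|i r IH]; first by rewrite !big_nil.
by rewrite !big_cons -IH.
Qed.

Lemma cell_sumE q k x c :
  cell_sum q k x 0 c = \sum_(n < J) g_ k (xs n) 0 c * cellf b q n x.
Proof.
rewrite /cell_sum test_sumE summxE; apply: eq_bigr => n _.
rewrite test_sumE summxE (bigD1 c)//= big1 => [|c' c'c].
  rewrite addr0; transitivity ((g_ k (xs n) 0 c *: test_val (T q n c) x) 0 c) =>
    //.
  by rewrite TE !mxE !eqxx mulr1.
transitivity ((g_ k (xs n) 0 c' *: test_val (T q n c') x) 0 c) => //.
by rewrite TE !mxE eqxx/= eq_sym (negbTE c'c) !mulr0.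
Qed.

Lemma cell_errE q k x c : (g_ k - cell_sum q k) x 0 c =
  g_ k x 0 c - \sum_(n < J) g_ k (xs n) 0 c * cellf b q n x.
Proof.
by rewrite -cell_sumE -[LHS]/((test_val (g_ k) x - test_val (cell_sum q k) x) 0
  c) !mxE.
Qed.

Let lim_err k x : 'rV[R]_p :=
  \row_c (g_ k x 0 c - \sum_(n < J) g_ k (xs n) 0 c * cell_ind b n x).

Lemma norm2_le_max (v : 'rV[R]_p) (B : R) : (forall c, `|v 0 c| <= B) ->
  norm2 v <= p%:R * B.
Proof.
move=> vB; apply: le_trans (norm2_le_sum _) _.
apply: le_trans (ler_sum _ (fun c _ => vB c)) _.
by rewrite sumr_const card_ord mulr_natl.
Qed.

(** In the limit [q -> oo] the error at a point of one of the first [J] cells is an oscillation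
    within that cell, at most [e]; elsewhere it is [g_ k] itself, bounded by [C] on a set of small
    measure. Each contributes at most [delta / 4], which leaves the strict inequality needed to
    return to finite [q]. *)
Lemma near_cell_approx : (Hfun (p%:R * e) * mX <= delta / 4) ->
  (Hfun (p%:R * C) * fine (m (rest (fun n => [set x | 0%R < b n x]) J)) <=
    delta / 4) ->
  forall k, (k < N)%N -> \forall q \near \oo,
  (\int[m]_x (Hfun (norm2 ((g_ k - cell_sum q k) x)))%:E <= delta%:E)%E.
Proof.
move=> He HC k kN.
pose U n := [set x | 0 < b n x].
have oU n : open (U n) by apply: open_positive; exact: sfun_continuous.
have mR := measurable_rest oU J.
pose h (x : borel_type X) : \bar R :=
  ((Hfun (p%:R * e))%:E + (Hfun (p%:R * C))%:E * (\1_(rest U J) x)%:E)%E.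
apply: (@dominated_le _ _ m _ (fun x => Hfun (norm2 (lim_err k x))) h
  (Hfun (p%:R * (C + \sum_(n < J) C)))).
- by move=> q; exact: measurable_Hfun.
- move=> q x; rewrite Hfun_ge0; apply: Hfun_le; first exact: norm2_ge0.
  apply: norm2_le_max => c.
  rewrite cell_errE.
  apply: le_trans (ler_normB _ _) _; apply: lerD; first exact: gC.
  apply: le_trans (ler_norm_sum _ _ _) _; apply: ler_sum => n _.
  rewrite normrM -[leRHS]mulr1; have /andP[h0 h1] := cellf01 b01 q n x.
  by apply: ler_pM => //; [exact: gC|rewrite ger0_norm].
- move=> x; apply: (@continuous_cvg _ _ _ _ _ _ (@Hfun R));
    first exact: continuous_Hfun.
  apply: (@continuous_cvg _ _ _ _ _ _ (@Num.sqrt R));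
    first exact: sqrt_continuous.
  apply: cvg_big => [|c _]; first exact: add_continuous.
  apply: (@continuous_cvg _ _ _ _ _ _ (fun t : R => t ^+ 2));
    first exact: exprn_continuous.
  rewrite mxE; under eq_fun => q do
    rewrite cell_errE.
  apply: cvgB; first exact: cvg_cst.
  apply: cvg_big => [|n _]; first exact: add_continuous.
  by apply: cvgMl_tmp; exact: cellf_cvg.
- apply: emeasurable_funD => //; apply: measurable_funeM.
  by apply/measurable_EFinP; exact: measurable_indic.
- move=> x; rewrite /h -EFinM -EFinD lee_fin.
  have [[n0 [n0J cx E]]|[b0 E]] := cell_ind_sum b01 J x.
    apply: ler_wpDr; first by rewrite mulr_ge0// Hfun_ge0.
    apply: Hfun_le; first exact: norm2_ge0.
    apply: norm2_le_max => c; rewrite mxE (E (fun n => g_ k (xs n) 0 c)).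
    by apply: (osc (n := n0)) => //; [exact: cx.1|exact: (xsP cx).1.1].
  rewrite indicE mem_set ?mulr1; last first.
    by move=> [n nJ]; rewrite /U /= b0// ltxx.
  apply: ler_wpDl; first exact: Hfun_ge0.
  apply: Hfun_le; first exact: norm2_ge0.
  apply: norm2_le_max => c; rewrite mxE (E (fun n => g_ k (xs n) 0 c)) subr0.
  exact: gC.
rewrite /h ge0_integralD//; last 3 first.
- by move=> x _; rewrite lee_fin Hfun_ge0.
- by move=> x _; rewrite -EFinM lee_fin mulr_ge0// Hfun_ge0.
- by apply: measurable_funeM; apply/measurable_EFinP; exact: measurable_indic.
rewrite int_cst ge0_integralZl//; last 2 first.
- by apply/measurable_EFinP; exact: measurable_indic.
- by rewrite lee_fin Hfun_ge0.
have II : (\int[m]_x (\1_(rest U J) x)%:E = (fine (m (rest U J)))%:E)%E.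
  by rewrite fineK ?fin_num_measure// integral_indic// setIT.
rewrite II -!EFinM -EFinD lte_fin;
  apply: (@le_lt_trans _ _ (delta / 4 + delta / 4)).
  exact: lerD.
by have := delta0; lra.
Qed.

(** In the limit only the cell containing [x] contributes, with weight [W (xs n) + 1 <= V x + 1] by
    the minimality of the sample point. This is why the bound depends neither on [J] nor on the
    cover. *)
Lemma near_weighted_mass : \forall q \near \oo,
  (\int[m]_x (\sum_(n < J) \sum_(c < p) (W (xs n)).+1%:R * Hfun (norm2 (T q n c
    x)))%:E
    <= weighted_mass%:E)%E.
Proof.
pose h (x : borel_type X) : \bar R := ((p%:R * Hfun 1)%:E * (V x + 1%:E))%E.
have nT q n c x : norm2 (T q n c x) = cellf b q n x.
  by rewrite TE norm2_delta//; have /andP[] := cellf01 b01 q n x.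
apply: (@dominated_le _ _ m _
  (fun x => \sum_(n < J) \sum_(c < p) (W (xs n)).+1%:R * Hfun (cell_ind b n x))
    h
  (\sum_(n < J) \sum_(c < p) (W (xs n)).+1%:R * Hfun 1)).
- move=> q; apply: measurable_sum => n; apply: measurable_sum => c.
  by apply: measurable_funM => //; exact: measurable_Hfun.
- move=> q x; rewrite sumr_ge0/=; last first.
    by move=> n _; apply: sumr_ge0 => c _; rewrite mulr_ge0// Hfun_ge0.
  apply: ler_sum => n _; apply: ler_sum => c _; rewrite ler_wpM2l// nT.
  by have /andP[h0 h1] := cellf01 b01 q n x; exact: Hfun_le.
- move=> x; apply: cvg_big => [|n _]; first exact: add_continuous.
  apply: cvg_big => [|c _]; first exact: add_continuous.
  apply: cvgMl_tmp; under eq_fun do rewrite nT.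
  by apply: (@continuous_cvg _ _ _ _ _ _ (@Hfun R));
    [exact: continuous_Hfun|exact: cellf_cvg].
- apply: measurable_funeM; exact: emeasurable_funD.
- move=> x.
  (* Since [Hfun 0 = 0], [Hfun] of an indicator is [Hfun 1] times the indicator. *)
  have -> : \sum_(n < J) \sum_(c < p) (W (xs n)).+1%:R * Hfun (cell_ind b n x) =
      \sum_(n < J) (p%:R * Hfun 1 * (W (xs n)).+1%:R) * cell_ind b n x :> R.
    apply: eq_bigr => n _; rewrite sumr_const card_ord -mulr_natl /cell_ind.
    by case: asboolP => _; rewrite ?Hfun0; ring.
  have pH0 : 0 <= p%:R * Hfun (1 : R) by rewrite mulr_ge0 ?Hfun_ge0.
  have [[n0 [n0J cx E]]|[b0 E]] := cell_ind_sum b01 J x.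
    rewrite (E (fun n => p%:R * Hfun 1 * (W (xs n)).+1%:R)) EFinM.
    apply: lee_wpmul2l; first by rewrite lee_fin.
    rewrite -natr1 EFinD; apply: leeD => //; apply: le_trans (WV x).
    by rewrite lee_fin ler_nat (xsP cx).2.
  rewrite (E (fun n => p%:R * Hfun 1 * (W (xs n)).+1%:R)).
  by apply: mule_ge0; [rewrite lee_fin|apply: adde_ge0].
rewrite /h ge0_integralZl//; last 3 first.
- exact: emeasurable_funD.
- by move=> x _; apply: adde_ge0.
- by rewrite lee_fin mulr_ge0 ?Hfun_ge0.
rewrite ge0_integralD//.
apply: (@le_lt_trans _ _ ((p%:R * Hfun 1 * (2 + mX))%:E)%E); last first.
  by rewrite lte_fin ltrDl.
rewrite [leRHS]EFinM; apply: lee_wpmul2l;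
  first by rewrite lee_fin mulr_ge0 ?Hfun_ge0.
by rewrite EFinD; apply: leeD => //; rewrite int_cst mul1r.
Qed.

End limit_in_q.

(** The choices are made in the order oscillation, cover, number of cells, and only then [q]: the
    finitely many estimates all hold for [q] near infinity, so a single [q] serves them. *)
Lemma cell_approximation : exists (J : nat) (T : nat -> 'I_p ->
  test M p) (xs : nat -> X),
  (forall k, (k < N)%N ->
    (\int[m]_x (Hfun (norm2 ((g_ k - \sum_(n < J) \sum_(c < p) g_ k (xs n) 0%R c
      *: T n c)%R x)))%:E
       <= delta%:E)%E) /\
  (\int[m]_x (\sum_(n < J) \sum_(c < p) (W (xs n)).+1%:R * Hfun (norm2 (T n c
    x)))%:E
    <= weighted_mass%:E)%E.
Proof.
have [C gC] := uniform_entry_bound.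
have d4 : 0 < delta / 4 by rewrite divr_gt0.
have [|e e0 He] := @Hfun_small p%:R (delta / 4 / (mX + 1)).
  by rewrite divr_gt0// ltr_wpDl.
have [b [sb b01 bcover osc]] := oscillation_cover hX scX g_ N e0.
have [xs xsP] := cell_min_point b W point.
pose U n := [set x | 0 < b n x].
have oU n : open (U n) by apply: open_positive; exact: sfun_continuous.
have HC0 : 0 < Hfun (p%:R * C) + 1 by rewrite ltr_wpDl// Hfun_ge0.
have [J _ JP] := @rest_small _ _ m U oU bcover (delta / 4 / (Hfun (p%:R * C) +
  1))
  (divr_gt0 d4 HC0).
have {}JP := JP J (leqnn J).
have : forall qnc : nat * nat * 'I_p, exists T : test M p,
    forall x, T x = cellf b qnc.1.1 qnc.1.2 x *: delta_mx 0 qnc.2 :> 'rV[R]_p.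
  by move=> [[q n] c]; apply: bump_test; [exact: cellf_sfun|move=> x;
    exact: cellf01].
move=> /choice[T' TE']; pose T q n c := T' (q, n, c).
have TE q n c x : T q n c x = cellf b q n x *: delta_mx 0 c :> 'rV[R]_p
  by exact: TE'.
have He' : Hfun (p%:R * e) * mX <= delta / 4.
  apply: le_trans (ler_wpM2r mX0 He) _.
  have F1 : mX / (mX + 1) <= 1 by rewrite ler_pdivrMr ?ltr_wpDl// mul1r lerDl.
  have -> : delta / 4 / (mX + 1) * mX = delta / 4 * (mX / (mX + 1)).
    by rewrite mulrAC mulrA.
  exact: ler_piMr (ltW d4) F1.
have HC' : Hfun (p%:R * C) * fine (m (rest U J)) <= delta / 4.
  have mR := measurable_rest oU J.
  have : fine (m (rest U J)) <= delta / 4 / (Hfun (p%:R * C) + 1).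
    by rewrite -lee_fin fineK// fin_num_measure.
  move=> /(ler_wpM2l (Hfun_ge0 (p%:R * C))) /le_trans; apply.
  have F1 : Hfun (p%:R * C) / (Hfun (p%:R * C) + 1) <= 1.
    by rewrite ler_pdivrMr// mul1r lerDl.
  by rewrite mulrCA; exact: ler_piMr (ltW d4) F1.
have A := @near_cell_approx b xs J e C sb b01 osc xsP gC T TE He' HC'.
have B := @near_weighted_mass b xs J b01 xsP T TE.
have : \forall q \near \oo, forall k : 'I_N,
  (\int[m]_x (Hfun (norm2 ((g_ k - cell_sum xs J T q k) x)))%:E <= delta%:E)%E.
  by apply: filter_forall => k; exact: A.
move=> {}A; have [q [Aq Bq]] := filter_ex (filterI A B).
exists J, (T q), xs; split=> // k kN.
exact: (Aq (Ordinal kN)).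
Qed.

End cell_approximation.

(** * Atoms as limits along an ultrafilter *)

Lemma fmap_ultra (T U : Type) (f : T -> U) (G : set_system T) :
  UltraFilter G -> UltraFilter (f @ G).
Proof.
move=> GU; have GP : ProperFilter G by exact: ultra_proper.
split=> [|H HP sH]; first exact: fmap_proper_filter.
apply/seteqP; split=> // A HA; have [//|nA] := in_ultra_setVsetC (f @^-1` A) GU.
have HnA : H (~` A) by exact: sH.
by have [y []] := filter_ex (filterI HA HnA).
Qed.

Section sums.
Context {R : realType}.

Lemma sum_inv_square_le (j n : nat) :
  \sum_(j.+1 <= i < n) (i.+1%:R ^+ 2)^-1 <= j.+1%:R^-1 :> R.
Proof.
have [nj|jn] := leqP n j.+1; first by rewrite big_geq// invr_ge0.
suff : \sum_(j.+1 <= i < n) (i.+1%:R ^+ 2)^-1 <= j.+1%:R^-1 - n%:R^-1 :> R.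
  by move=> /le_trans; apply; rewrite gerBl invr_ge0.
move/ltnW: jn; elim: n => [//|n IH]; rewrite leq_eqVlt => /predU1P[<-|jn].
  by rewrite big_geq// subrr.
rewrite big_nat_recr//=.
apply: le_trans (lerD (IH jn) (lexx _)) _.
have n0 : 0 < n%:R :> R by rewrite ltr0n; case: n jn {IH}.
rewrite -addrA lerD2l -natr1; set t : R := n%:R in n0 *.
rewrite -subr_ge0.
(* Telescoping: [1/t - 1/(t+1)] exceeds [1/(t+1)^2] by exactly [1/(t (t+1)^2)]. *)
have -> : - (t + 1)^-1 - (- t^-1 + ((t + 1) ^+ 2)^-1) = (t * (t + 1) ^+ 2)^-1.
  by field; rewrite !gt_eqF// ltr_wpDl// ltW.
by rewrite invr_ge0 mulr_ge0 ?sqr_ge0 ?ltW.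
Qed.

(** In decreasing order the first [j + 1] terms are all at least the one of index [j], so their sum
    is at least [j + 1] times it. *)
Lemma sorted_weights (T : eqType) (a : T -> R) (s : seq T) (V : R) :
  (forall u, 0 <= a u) -> \sum_(u <- s) a u <= V ->
  exists2 s' : seq T, perm_eq s s' &
    forall x0 j, (j < size s')%N -> j.+1%:R * a (nth x0 s' j) <= V.
Proof.
move=> a0 aV; pose leT u v := a v <= a u.
exists (sort leT s); first by rewrite perm_sym perm_sort.
move=> x0 j js.
have st : sorted leT (sort leT s) by apply: sort_sorted => u v; exact: le_total.
apply: le_trans aV; rewrite -(perm_big _ (permEl (perm_sort leT s)))/=.
rewrite (big_nth x0) (big_cat_nat _ js)//=.
rewrite -[leLHS]addr0; apply: lerD; last exact: sumr_ge0.
rewrite mulr_natl -[X in _ *+ X]subn0 -sumr_const_nat.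
rewrite [leLHS]big_nat [leRHS]big_nat; apply: ler_sum => i /andP[_ ij].
have tr : transitive leT by move=> u v w uv vw; exact: le_trans vw uv.
have rf : reflexive leT by move=> u; exact: lexx.
by apply: (sorted_leq_nth tr rf x0 st); rewrite ?inE//; exact: leq_ltn_trans js.
Qed.

(* Tannery's theorem, in a form whose conclusion can serve again as a
   hypothesis. *)
Lemma tannery (I : Type) (F : set_system I) {FF : ProperFilter F}
    (phi : I -> nat -> R) (phil : nat -> R) (S : I -> R) (L B : R) :
  (forall j, phi i j @[i --> F] --> phil j) ->
  (forall K, \forall i \near F,
    `|S i - \sum_(0 <= j < K.+1) phi i j| <= B / K.+1%:R) ->
  S i @[i --> F] --> L ->
  forall K, `|L - \sum_(0 <= j < K.+1) phil j| <= B / K.+1%:R.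
Proof.
move=> cphi HB cS K.
have cT : `|S i - \sum_(0 <= j < K.+1) phi i j| @[i --> F] -->
    `|L - \sum_(0 <= j < K.+1) phil j|.
  apply: cvg_norm; apply: cvgB => //.
  by apply: cvg_big => [|j _]; [exact: add_continuous|exact: cphi].
rewrite -(cvg_lim _ cT)//; apply: limr_le; last exact: HB.
by apply/cvg_ex; eexists; exact: cT.
Qed.

End sums.

(** * Limits of weighted sums of atoms *)

Section atomic_limit.
Context {R : realType} {X : ptopologicalType} {p : nat}.
Variables (W : X -> nat).
Hypothesis cW : forall r, exists2 C : set X, compact C &
  forall x, (W x <= r)%N -> C x.

(** Taken component by component, because the moment bound controls the pairing with each component
    of a test function separately. *)
Definition sqrt_mass (c : 'rV[R]_p) : R := \sum_(k < p) Num.sqrt `|c 0 k|.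

Lemma sqrt_mass_ge0 (c : 'rV[R]_p) : 0 <= sqrt_mass c.
Proof. by apply: sumr_ge0 => k _; exact: sqrtr_ge0. Qed.

Lemma sum_abs_le_sqrt_mass (c : 'rV[R]_p) : \sum_(k < p) `|c 0 k| <=
  sqrt_mass c ^+ 2.
Proof.
rewrite expr2 [leRHS]mulr_suml; apply: ler_sum => k _.
rewrite -{1}[`|c 0 k|]sqr_sqrtr// expr2 ler_wpM2l ?sqrtr_ge0//.
by rewrite /sqrt_mass (bigD1 k)//= lerDl sumr_ge0// => i _; exact: sqrtr_ge0.
Qed.

(** The value at [f] of the atom [c delta_x], for [u = (c, x)]. *)
Definition dotf (f : X -> 'rV[R]_p) (u : 'rV[R]_p * X) : R :=
  \sum_(k < p) u.1 0 k * f u.2 0 k.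

Lemma dotf_le (f : X -> 'rV[R]_p) (C : R) (u : 'rV[R]_p * X) : 0 <= C ->
  (forall x k, `|f x 0 k| <= C) ->
  `|dotf f u| <= C * sqrt_mass u.1 ^+ 2.
Proof.
move=> C0 fC; apply: le_trans (ler_norm_sum _ _ _) _.
apply: (@le_trans _ _ (C * \sum_(k < p) `|u.1 0 k|)); last first.
  by rewrite ler_wpM2l// sum_abs_le_sqrt_mass.
rewrite mulr_sumr; apply: ler_sum => k _.
by rewrite normrM mulrC ler_wpM2r.
Qed.

(** If [W] of the points is bounded along [G], the points stay in a compact set and converge. If
    not, the ultrafilter forces [W] above every bound, so the weighted estimate sends the vectors to
    0 and the atom disappears from every bounded [f]. *)
Lemma ultra_limit (G : set_system nat) (v : nat -> 'rV[R]_p) (x : nat ->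
  X) (B V : R) :
  UltraFilter G -> (\forall N \near G, sqrt_mass (v N) <= B) ->
  (\forall N \near G, (W (x N)).+1%:R * sqrt_mass (v N) <= V) ->
  exists u : 'rV[R]_p * X, (v N @[N --> G] --> u.1) /\
    forall f : X -> 'rV[R]_p, (forall k, continuous (fun x => f x 0 k)) ->
      forall C : R, (forall x k, `|f x 0 k| <= C) ->
      dotf f (v N, x N) @[N --> G] --> dotf f u.
Proof.
move=> GU vB vV; have GP : ProperFilter G by exact: ultra_proper.
have B0 : 0 <= B.
  by have [N vN] := filter_ex vB; exact: le_trans (sqrt_mass_ge0 _) vN.
have entry (c : 'rV[R]_p) k : `|c 0 k| <= sqrt_mass c ^+ 2.
  apply: le_trans (sum_abs_le_sqrt_mass c).
  by rewrite (bigD1 k)//= lerDl sumr_ge0.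
pose K := [set y : 'rV[R]_p | `|y - 0| <= B ^+ 2 + 1].
have cK : compact K by apply: rV_ball_compact; rewrite ltr_wpDl// sqr_ge0.
have [vl [_ vlP]] : K `&` [set l | v N @[N --> G] --> l] !=set0.
  move: cK; rewrite compact_ultra => /(_ (v @ G) (fmap_ultra v GU)); apply.
  apply: filterS vB => N vN; rewrite /K /= subr0; apply: normr_mx_le.
    by rewrite addr_ge0// sqr_ge0.
  move=> k; apply: le_trans (entry _ _) _; apply: ler_wpDr => //.
  by apply: lerXn2r; rewrite ?nnegrE ?sqrt_mass_ge0.
have cv k : v N 0 k @[N --> G] --> vl 0 k.
  by apply: (@continuous_cvg _ _ _ _ _ _ (fun y : 'rV[R]_p => y 0 k)) vlP;
    exact: coord_continuous.
have [[r Wr]|nWr] := pselect (exists r, \forall N \near G, (W (x N) <= r)%N).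
  have [C cC WC] := cW r.
  have [xl [_ xlP]] : C `&` [set l | x N @[N --> G] --> l] !=set0.
    move: cC; rewrite compact_ultra => /(_ (x @ G) (fmap_ultra x GU)); apply.
    by apply: filterS Wr => N; exact: WC.
  exists (vl, xl); split=> // f cf C' fC'.
  apply: cvg_big => [|k _]; first exact: add_continuous.
  apply: cvgM; first exact: cv.
  by apply: (@continuous_cvg _ _ _ _ _ _ (fun y : X => f y 0 k)) xlP; exact: cf.
have vk0 e k : 0 < e -> \forall N \near G, `|v N 0 k| <= e.
  (* Once [W] exceeds this [r], a mass larger than [sqrt e] would make the weighted mass exceed
     [V]. *)
  move=> e0; pose r := Num.truncn (V / Num.sqrt e).
  have : G (~` [set N | (W (x N) <= r)%N]).
    have [Wr|//] := in_ultra_setVsetC [set N | (W (x N) <= r)%N] GU.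
    by exfalso; apply: nWr; exists r.
  have se : 0 < Num.sqrt e by rewrite sqrtr_gt0.
  apply: filterS2 vV => N vN /negP; rewrite -ltnNge => rW.
  apply: le_trans (entry _ _) _; rewrite -[leRHS]sqr_sqrtr ?(ltW e0)//.
  apply: lerXn2r; rewrite ?nnegrE ?sqrt_mass_ge0 ?sqrtr_ge0//.
  rewrite leNgt; apply/negP => ev.
  have : V < V.
    apply: lt_le_trans vN; apply: lt_trans (_ : (W (x N)).+1%:R * Num.sqrt e <
      _); last first.
      by rewrite ltr_pM2l.
    rewrite -ltr_pdivrMr//; apply: lt_le_trans (truncnS_gt _) _.
    by rewrite ler_nat ltnS ltnW.
  by rewrite ltxx.
have vl0 k : vl 0 k = 0.
  have c0 : v N 0 k @[N --> G] --> (0 : R).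
    apply/cvgrPdist_le => e e0; apply: filterS (vk0 e k e0) => N.
    by rewrite sub0r normrN.
  by apply: (cvg_unique _ (cv k) c0); exact: Rhausdorff.
(* The limiting vector is 0, so any point will do. *)
exists (vl, point); split=> // f cf C fC.
have -> : dotf f (vl, point) = 0.
  by rewrite /dotf big1// => k _; rewrite vl0 mul0r.
rewrite [X in _ --> X](_ : 0 = \sum_(k < p) (0 : R)); last by rewrite big1.
apply: cvg_big => [|k _]; first exact: add_continuous.
apply/cvgrPdist_le => e e0.
have C1 : 0 < `|C| + 1 by rewrite ltr_wpDl.
apply: filterS (vk0 (e / (`|C| + 1)) k (divr_gt0 e0 C1)) => N vN /=.
rewrite sub0r normrN normrM -[leRHS](divfK (lt0r_neq0 C1)).
apply: ler_pM => //; apply: le_trans (fC _ _) _.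
by apply: ler_wpDr => //; exact: ler_norm.
Qed.

Variables (J : nat -> nat) (c : nat -> nat -> 'rV[R]_p) (x : nat -> nat ->
  X) (V : R).
Hypothesis bounded_often : forall N0, exists2 N, (N0 <= N)%N &
  \sum_(0 <= n < J N) (W (x N n)).+1%:R * sqrt_mass (c N n) <= V.

(** In sorted order the term of index [j] is at most [C (V / (j+1))^2] for every good [N], so the
    tails are bounded uniformly in [N]. The conclusion is a rate rather than a convergence because
    it must pass to one more limit, over test functions sharing the bound [C]. *)
Lemma atomic_limit : exists u : nat -> 'rV[R]_p * X,
  (forall j, norm2 (u j).1 <= V ^+ 2 / j.+1%:R ^+ 2) /\
  forall (f : X -> 'rV[R]_p) (C L : R), 0 <= C ->
    (forall k, continuous (fun x => f x 0 k)) ->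
      (forall x k, `|f x 0 k| <= C) ->
    (\sum_(0 <= n < J N) dotf f (c N n, x N n)) @[N --> \oo] --> L ->
    forall K, `|L - \sum_(0 <= j < K.+1) dotf f (u j)| <=
      (C * V ^+ 2) / K.+1%:R.
Proof.
pose good N := \sum_(0 <= n < J N) (W (x N n)).+1%:R * sqrt_mass (c N n) <= V.
(* Proper precisely because good indices occur infinitely often; an ultrafilter refining it keeps
   every limit along [\oo]. *)
have : ProperFilter (within good \oo).
  apply: Build_ProperFilter_ex => A [N0 _ NA].
  by have [N N0N gN] := bounded_often N0; exists N; exact: NA.
move=> /ultraFilterLemma[G [GU sG]];
  have GP : ProperFilter G by exact: ultra_proper.
have Ggood : \forall N \near G, good N by apply: sG; exists 0%N.
have Goo (A : set nat) : \oo A -> G A.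
  by move=> Ao; apply: sG; apply: filterS Ao => N AN _.
pose s N := [seq (c N n, x N n) | n <- index_iota 0 (J N)].
have : forall N, exists s' : seq ('rV[R]_p * X), perm_eq (s N) s' /\ (good N ->
    forall j, (j < size s')%N ->
      j.+1%:R * sqrt_mass (nth (0, point) s' j).1 <= V).
  move=> N; have [gN|ngN] := pselect (good N); last by exists (s N).
  have [||s' ss' s'P] := @sorted_weights R _ (fun u => sqrt_mass u.1) (s N) V.
  - by move=> u; exact: sqrt_mass_ge0.
  - rewrite big_map; apply: le_trans gN; apply: ler_sum => n _.
    (* The weights [W + 1] are at least 1, so they may be dropped for the sorting. *)
    by rewrite ler_peMl ?sqrt_mass_ge0// ler1n.
  by exists s'; split=> // _ j; exact: s'P.
move=> /choice[s' s'P].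
(* Beyond the end of the list the atom has vector 0 and contributes nothing. *)
pose y j N := nth (0, point) (s' N) j.
have V0 : 0 <= V.
  have [N gN] := filter_ex Ggood; apply: le_trans gN.
  by apply: sumr_ge0 => n _; rewrite mulr_ge0// sqrt_mass_ge0.
have m0 : sqrt_mass 0 = 0.
  by rewrite /sqrt_mass big1// => k _; rewrite mxE normr0 sqrtr0.
have ysort j N : good N -> sqrt_mass (y j N).1 <= V / j.+1%:R.
  move=> gN; rewrite ler_pdivlMr// mulrC; have [js|sj] := ltnP j (size (s' N)).
    exact: (s'P N).2.
  by rewrite /y nth_default// m0 mulr0.
have yW j N : good N -> (W (y j N).2).+1%:R * sqrt_mass (y j N).1 <= V.
  move=> gN; have [js|sj] := ltnP j (size (s' N)); last first.
    by rewrite /y nth_default// m0 mulr0.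
  have : y j N \in s N by rewrite (perm_mem (s'P N).1) mem_nth.
  move=> /mapP[n]; rewrite mem_index_iota => /andP[_ nJ] ->/=.
  apply: le_trans gN; rewrite big_mkord (bigD1 (Ordinal nJ))//= lerDl.
  by apply: sumr_ge0 => i _; rewrite mulr_ge0// sqrt_mass_ge0.
have : forall j, exists u : 'rV[R]_p * X, ((y j N).1 @[N --> G] --> u.1) /\
    forall f : X -> 'rV[R]_p, (forall k, continuous (fun x => f x 0 k)) ->
      forall C : R, (forall x k, `|f x 0 k| <= C) ->
      dotf f (y j N) @[N --> G] --> dotf f u.
  move=> j; have [||u [uy uP]] := @ultra_limit G (fun N => (y j N).1)
    (fun N => (y j N).2) (V / j.+1%:R) V GU.
  - by apply: filterS Ggood => N; exact: ysort.
  - by apply: filterS Ggood => N; exact: yW.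
  exists u; split; first exact: uy.
  move=> f cf C fC; have := uP f cf C fC.
  by under eq_fun do rewrite -surjective_pairing.
move=> /choice[u uP]; exists u; split.
  move=> j; have [uy _] := uP j.
  have cy : norm2 (y j N).1 @[N --> G] --> norm2 (u j).1.
    apply: (@continuous_cvg _ _ _ _ _ _ (@norm2 R p)) uy.
    by apply: (norm2_continuous (g := id)) => k; exact: coord_continuous.
  rewrite -(cvg_lim _ cy)//; apply: limr_le.
    by apply/cvg_ex; eexists; exact: cy.
  apply: filterS Ggood => N gN.
  apply: le_trans (norm2_le_sum _) _;
    apply: le_trans (sum_abs_le_sqrt_mass _) _.
  rewrite -expr_div_n; apply: lerXn2r;
    rewrite ?nnegrE ?sqrt_mass_ge0 ?divr_ge0//.
  exact: ysort.
move=> f C L C0 cf fC SL.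
apply: (@tannery _ _ G GP (fun N j => dotf f (y j N)) _
  (fun N => \sum_(0 <= n < J N) dotf f (c N n, x N n))).
- by move=> j; exact: (uP j).2 cf C fC.
- move=> K; apply: filterS Ggood => N gN.
  have term j : `|dotf f (y j N)| <= C * V ^+ 2 * (j.+1%:R ^+ 2)^-1.
    apply: le_trans (dotf_le _ C0 fC) _; rewrite -mulrA ler_wpM2l// -expr_div_n.
    by apply: lerXn2r; rewrite ?nnegrE ?sqrt_mass_ge0 ?divr_ge0//; exact: ysort.
  (* Padding to this common length lets the full sum be cut at [K + 1] even when the list is
     shorter. *)
  pose m := maxn (size (s' N)) K.+1.
  have -> : \sum_(0 <= n < J N) dotf f (c N n,
    x N n) = \sum_(0 <= j < m) dotf f (y j N).
    rewrite -(big_map (fun n => (c N n, x N n)) xpredT (dotf f)) -/(s N).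
    rewrite (perm_big _ (s'P N).1) (big_nth (0, point)).
    rewrite [RHS](big_cat_nat (n := size (s' N)))//=; last exact: leq_maxl.
    rewrite [X in _ = _ + X](_ : _ =
      0) ?addr0// big_nat big1// => j /andP[sj _].
    by rewrite /dotf big1// => k _; rewrite /y nth_default// mxE mul0r.
  rewrite (big_cat_nat (n := K.+1))//=; last exact: leq_maxr.
  rewrite addrAC subrr add0r; apply: le_trans (ler_norm_sum _ _ _) _.
  apply: le_trans (ler_sum _ (fun j _ => term j)) _.
  rewrite -mulr_sumr ler_wpM2l ?mulr_ge0 ?sqr_ge0//.
  exact: sum_inv_square_le.
- by move=> A /SL /Goo.
Qed.

End atomic_limit.

(** * Concentration *)

Section almost_sure.
Context {R : realType} {dT : measure_display} {T : measurableType dT}.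
Variable mu : {measure set T -> \bar R}.

Lemma ge0_integral_lty_ae (F : T -> \bar R) : measurable_fun setT F ->
  (forall w, (0 <= F w)%E) -> (\int[mu]_w F w < +oo)%E ->
  \forall w \ae mu, F w \is a fin_num.
Proof.
move=> mF F0 iF; have : mu.-integrable setT F.
  apply/integrableP; split=> //.
  by under eq_integral do rewrite gee0_abs//.
by move=> /(integrable_ae measurableT); apply: filterS => w; exact.
Qed.

(** By Fatou the lower limit has a finite integral, hence is almost everywhere finite, and the
    sequence falls infinitely often below the lower limit plus 1. *)
Lemma ae_bounded_often (S : nat -> T -> R) (B : R) :
  (forall N, measurable_fun setT (S N)) -> (forall N w, 0 <= S N w) ->
  (forall N, (\int[mu]_w (S N w)%:E <= B%:E)%E) ->
  \forall w \ae mu, exists V : R, forall N0, exists2 N, (N0 <= N)%N &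
    S N w <= V.
Proof.
move=> mS S0 iS.
have mES N : measurable_fun setT (EFin \o S N) by exact/measurable_EFinP.
pose F w : \bar R := limn_einf (fun N => (S N w)%:E).
have einf0 w : (0 <= F w)%E.
  rewrite /F limn_einf_lim; apply: lime_ge; first exact: is_cvg_einfs.
  apply: nearW => N; apply: le_ereal_inf_tmp => _ [N' _ <-].
  by rewrite lee_fin.
have iF : (\int[mu]_w F w <= B%:E)%E.
  apply: le_trans (fatou mu measurableT mES _) _; first by move=> N w _;
    rewrite lee_fin.
  rewrite limn_einf_lim; apply: lime_le; first exact: is_cvg_einfs.
  apply: nearW => N; apply: le_trans (ereal_inf_lbound _) (iS N).
  by exists N => //=.
have mF : measurable_fun setT F.
  apply: (measurableT_comp (f := -%E)) => //;
    apply: measurable_fun_limn_esup => N.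
  by apply: (measurableT_comp (f := -%E)) => //; exact: mES.
have : \forall w \ae mu, F w \is a fin_num.
  by apply: ge0_integral_lty_ae => //; exact: le_lt_trans iF (ltry _).
apply: filterS => w Fw; exists (fine (F w) + 1) => N0.
apply: contrapT => H.
have : ((fine (F w) + 1)%:E <= F w)%E.
  rewrite {2}/F limn_einf_lim; apply: lime_ge; first exact: is_cvg_einfs.
  exists N0 => // N /= N0N; apply: le_ereal_inf_tmp => _ [N' /= NN' <-].
  rewrite lee_fin leNgt; apply/negP => SN'; apply: H; exists N';
    last exact: ltW.
  exact: leq_trans NN'.
by rewrite -{2}(fineK Fw) lee_fin gerDl ler10.
Qed.

(** The series of the [f N] has a finite integral, so it converges almost everywhere and its terms
    tend to 0. *)
Lemma ae_summable_cvg0 (f : nat -> T -> R) (B : R) :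
  (forall N, measurable_fun setT (f N)) -> (forall N w, 0 <= f N w) ->
  (forall N, (\int[mu]_w (f N w)%:E <= (B * (2^-1) ^+ N)%:E)%E) ->
  \forall w \ae mu, f N w @[N --> \oo] --> (0 : R).
Proof.
move=> mf f0 itf.
have B0 : 0 <= B.
  rewrite -lee_fin -[B]mulr1; apply: le_trans (itf 0%N).
  by apply: integral_ge0 => w _; rewrite lee_fin.
pose F w : \bar R := (\sum_(0 <= N <oo) (f N w)%:E)%E.
have mEf N : measurable_fun setT (EFin \o f N) by exact/measurable_EFinP.
have f0E N w : (0 <= (f N w)%:E)%E by rewrite lee_fin.
have iF : (\int[mu]_w F w <= (B * 2)%:E)%E.
  rewrite integral_nneseries//; apply: lime_le.
    by apply: is_cvg_nneseries => N _ _; apply: integral_ge0.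
  apply: nearW => n.
  apply: (@le_trans _ _ (\sum_(0 <= N < n) (B * (2^-1) ^+ N)%:E)%E).
    by apply: lee_sum.
  rewrite sumEFin lee_fin -mulr_sumr ler_wpM2l//.
  exact: sum_half_le.
have : \forall w \ae mu, F w \is a fin_num.
  apply: ge0_integral_lty_ae.
  - by apply: ge0_emeasurable_sum => [N w _ _|N _]; [exact: f0E|exact: mEf].
  - by move=> w; apply: nneseries_ge0.
  - exact: le_lt_trans iF (ltry _).
apply: filterS => w Fw; apply: cvg_series_cvg_0; apply: nondecreasing_is_cvgn.
  exact: nondecreasing_series.
exists (fine (F w)) => _ [n _ <-]; rewrite -lee_fin fineK// -sumEFin.
exact: nneseries_lim_ge.
Qed.

End almost_sure.

Section concentration.
Context {R : realType} {d : nat} {X : ptopologicalType}.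
Variables (M : smooth_atlas R d X) (p : nat).

Lemma pairing_sum (xi : dist M p) (I : Type) (r : seq I) (F : I -> test M p) :
  pairing xi (\sum_(i <- r) F i) = \sum_(i <- r) pairing xi (F i).
Proof. by rewrite /pairing linear_sum. Qed.

Lemma pairingB (xi : dist M p) (f g : test M p) :
  pairing xi (f - g) = pairing xi f - pairing xi g.
Proof. by rewrite /pairing linearB. Qed.

Variables (W : X -> nat).
Hypothesis cW : forall r, exists2 C : set X, compact C &
  forall x, (W x <= r)%N -> C x.
Variable D : nat -> test M p.
Hypothesis denseD : forall g, exists u : nat ->
  nat, test_cvg (fun n => D (u n)) g.
Variables (J : nat -> nat) (T : nat -> nat -> 'I_p -> test M p) (xs : nat ->
  nat -> X).

Definition cell_error N k : test M p :=
  D k - \sum_(n < J N) \sum_(c < p) D k (xs N n) 0 c *: T N n c.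

Definition weighted_sqrt N (xi : dist M p) : R :=
  \sum_(n < J N) \sum_(c < p) (W (xs N n)).+1%:R * Num.sqrt `|pairing xi (T N n
    c)|.

(** Two successive limits: in [N] for each function of the dense family, then along a sequence of
    that family converging to a given [g]. The atoms [u] are fixed in the first and are the same for
    all functions. *)
Lemma atomic_of_limits (xi : dist M p) (V : R) :
  (forall N0, exists2 N, (N0 <= N)%N & weighted_sqrt N xi <= V) ->
  (forall k, pairing xi (cell_error N k) @[N --> \oo] --> (0 : R)) ->
  atomic_dist M p xi.
Proof.
move=> often err.
pose c N n : 'rV[R]_p := \row_k pairing xi (T N n k).
have often' N0 : exists2 N, (N0 <= N)%N &
    \sum_(0 <= n < J N) (W (xs N n)).+1%:R * sqrt_mass (c N n) <= V.
  have [N N0N HN] := often N0; exists N => //; apply: le_trans HN.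
  rewrite big_mkord; apply: ler_sum => n _; rewrite mulr_sumr.
  by apply: ler_sum => k _; rewrite mxE.
have [u [uV uP]] := atomic_limit cW often'.
have entry_le (g : test M p) (C : R) : (forall x, norm2 (g x) <= C) ->
    forall x k, `|g x 0 k| <= C.
  by move=> gC x k; apply: le_trans (normr_le_norm2 _ _) (gC x).
have cg (g : test M p) k : continuous (fun x => g x 0 k).
  exact: sfun_continuous (test_coord_sfun g k).
have bD k (C : R) : 0 <= C -> (forall x, norm2 (D k x) <= C) -> forall K,
    `|pairing xi (D k) - \sum_(0 <= j < K.+1) dotf (D k) (u j)| <=
      C * V ^+ 2 / K.+1%:R.
  move=> C0 DC; apply: uP => //; first exact: entry_le.
  have -> : (fun N => \sum_(0 <= n < J N) dotf (D k) (c N n, xs N n)) =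
      (fun N => pairing xi (D k) - pairing xi (cell_error N k)).
    apply/funext => N; rewrite pairingB opprB addrC subrK pairing_sum big_mkord.
    apply: eq_bigr => n _; rewrite pairing_sum; apply: eq_bigr => k' _.
    by rewrite pairingZ mxE mulrC.
  rewrite -[X in _ --> X]subr0; apply: cvgB; last exact: err.
  exact: cvg_cst.
(* The approximants of [g] share one bound [C], hence one rate; the atoms and [xi] are both
   sequentially continuous, so the rate passes to [g]. *)
have bg (g : test M p) : exists B : R, forall K,
    `|pairing xi g - \sum_(0 <= j < K.+1) dotf g (u j)| <= B / K.+1%:R.
  have [r Dr] := denseD g; have [[C DC] _] := Dr.
  have C0 : 0 <= C by apply: le_trans (DC 0%N point); exact: norm2_ge0.
  exists (C * V ^+ 2).
  apply: (@tannery _ _ \oo _ (fun i j => dotf (D (r i)) (u j)) _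
    (fun i => pairing xi (D (r i)))).
  - move=> j; have := @dist_continuous _ _ _ _ _ (delta M (u j).1 (u j).2) _ _
      Dr.
    by rewrite /= /delta_fun /dotf.
  - by move=> K; apply: nearW => i; apply: bD.
  - exact: (@dist_continuous _ _ _ _ _ xi _ _ Dr).
exists (fun j => (u j).1), (fun j => (u j).2); split.
  apply: nondecreasing_is_cvgn.
    by apply: nondecreasing_series => j _ _; exact: norm2_ge0.
  (* The inverse squares sum to at most 2: the first is 1, the others sum to at most 1. *)
  exists (V ^+ 2 * 2) => _ [n _ <-].
  apply: (@le_trans _ _ (\sum_(0 <= j < n.+1) V ^+ 2 * (j.+1%:R ^+ 2)^-1)).
    rewrite big_nat_recr//=; apply: ler_wpDr.
      by rewrite mulr_ge0 ?sqr_ge0// invr_ge0 sqr_ge0.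
    by apply: ler_sum => j _; exact: uV.
  rewrite -mulr_sumr ler_wpM2l ?sqr_ge0// big_nat_recl//= expr1n invr1.
  rewrite -[leRHS]/(1 + 1 : R) lerD2l.
  have := @sum_inv_square_le R 0 n.+1; rewrite invr1 => /(le_trans _); apply.
  by rewrite big_add1.
move=> g; have [B BP] := bg g.
apply/cvgrPdist_le => e e0.
have B0 : 0 < `|B| + 1 by rewrite ltr_wpDl.
have eB : 0 < e / (`|B| + 1) by rewrite divr_gt0.
have [N0 _ N0P] := near_infty_natSinv_lt (PosNum eB).
(* The rate concerns partial sums with [K + 1] terms, hence the shift and the discarded empty
   sum. *)
exists N0.+1 => // -[//|K] /= N0K.
apply: le_trans (BP K) _; apply: le_trans (ler_norm _) _.
rewrite normrM [X in _ * X]ger0_norm ?invr_ge0//.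
have := N0P K N0K => /= /ltW.
move=> /(ler_wpM2l (ltW B0)); rewrite (mulrC _ (e / _)) divfK ?gt_eqF// => H.
apply: le_trans _ H; rewrite ler_wpM2r ?invr_ge0//.
by rewrite lerDl.
Qed.

End concentration.

Theorem theorem4p1 (R : realType) (n : nat) (n_ge2 : (2 <= n)%N)
    (d : nat) (X : ptopologicalType) (M : smooth_manifold R d X)
    (m : {finite_measure set (borel_type X) -> \bar R})
    (m_continuous : forall x : X, m [set x] = 0%E)
    (mu : probability (borel_type (dist M n.-1)) R)
    (mu_fourier : forall g : test M n.-1,
      fourier mu g =
      (expR (- (1 / 2) *
        \int[m]_x ln (1 + 1 / 4 * norm2 (g x) ^+ 2)))%:C%C) :
  mu.-negligible (~` atomic_dist M n.-1).
Proof.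
have hX := mfd_hausdorff M; have scX := mfd_second_countable M.
have [i_ [U [K [patches coverU]]]] := compact_patches M scX.
have [W [V [cW mV V0 WV iV]]] := @integrable_weight R X m U
  (fun l => let: And4 oU _ _ _ := patches l in oU) coverU K
  (fun l => let: And4 _ UK _ _ := patches l in UK)
  (fun l => let: And4 _ _ cK _ := patches l in cK).
have [D denseD] := @test_countable_dense _ _ _ M n.-1 scX.
(* The precision at stage [N] is [2^-N], so that the errors are summable over the stages. *)
have e0 N : 0 < (2^-1 : R) ^+ N by rewrite exprn_gt0.
have : forall N, exists JTx : nat * (nat -> 'I_n.-1 -> test M n.-1) * (nat ->
  X),
    (forall k, (k < N)%N ->
      (\int[m]_x (Hfun (norm2 ((D k - \sum_(i < JTx.1.1) \sum_(c < n.-1)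
        D k (JTx.2 i) 0%R c *: JTx.1.2 i c)%R x)))%:E <= ((2^-1) ^+ N)%:E)%E) /\
    (\int[m]_x (\sum_(i < JTx.1.1) \sum_(c < n.-1)
        (W (JTx.2 i)).+1%:R * Hfun (norm2 (JTx.1.2 i c x)))%:E
      <= (weighted_mass n.-1 m)%:E)%E.
  move=> N; have [J [T [xs H]]] :=
    cell_approximation hX scX mV V0 WV iV D N (e0 N).
  by exists (J, T, xs).
move=> /choice[JTx JTxP].
pose J N := (JTx N).1.1; pose T N := (JTx N).1.2; pose xs N := (JTx N).2.
have [C C0 CP] := sqrt_moment mu_fourier.
have msq := @measurable_sqrt_pairing R d X M n.-1.
have sqrt0 (g : test M n.-1) xi : (0 <= (Num.sqrt `|pairing xi g|)%:E)%E.
  by rewrite lee_fin sqrtr_ge0.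
have often : \forall xi \ae mu, exists B : R, forall N0, exists2 N,
  (N0 <= N)%N &
    weighted_sqrt W J T xs N xi <= B.
  apply: (@ae_bounded_often _ _ _ mu _ (C * weighted_mass n.-1 m)).
  - move=> N; apply: measurable_sum => i; apply: measurable_sum => c.
    by apply: measurable_funM => //; exact: msq.
  - move=> N xi; apply: sumr_ge0 => i _; apply: sumr_ge0 => c _.
    by rewrite mulr_ge0// sqrtr_ge0.
  move=> N; have [_ HN] := JTxP N.
  apply: le_trans (_ : C%:E * \int[m]_x (\sum_(i < J N) \sum_(c < n.-1)
    (W (xs N i)).+1%:R * Hfun (norm2 (T N i c x)))%:E <= _)%E; last first.
    by rewrite EFinM; apply: lee_wpmul2l => //; rewrite lee_fin.
  (* Stated for an arbitrary measure because it is used with [mu] on one side and [m] on the other,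
     so that the moment bound applies term by term. *)
  have swap (S : measure_display) (Y : measurableType S) (nu : {measure set Y ->
    \bar R})
      (F : nat -> 'I_n.-1 -> Y -> R) :
      (forall i c, measurable_fun setT (F i c)) ->
        (forall i c y, 0 <= F i c y) ->
      (\int[nu]_y (\sum_(i < J N) \sum_(c < n.-1) (W (xs N i)).+1%:R * F i c
        y)%:E =
      \sum_(i < J N) \sum_(c < n.-1) ((W (xs N i)).+1%:R)%:E * \int[nu]_y (F i c
        y)%:E)%E.
    move=> mF F0.
    under eq_integral do rewrite -sumEFin.
    rewrite ge0_integral_sum//; last 2 first.
    - move=> i; apply/measurable_EFinP; apply: measurable_sum => c.
      exact: measurable_funM.
    - by move=> i y _; rewrite lee_fin sumr_ge0// => c _; rewrite mulr_ge0.
    apply: eq_bigr => i _; under eq_integral do rewrite -sumEFin.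
    rewrite ge0_integral_sum//; last 2 first.
    - by move=> c; apply/measurable_EFinP; exact: measurable_funM.
    - by move=> c y _; rewrite lee_fin mulr_ge0.
    apply: eq_bigr => c _; under eq_integral do rewrite EFinM.
    rewrite ge0_integralZl//; first exact/measurable_EFinP.
    by move=> y _; rewrite lee_fin.
  rewrite (swap _ _ mu (fun i c xi => Num.sqrt `|pairing xi (T N i c)|));
    last 2 first.
  - by move=> i c; exact: msq.
  - by move=> i c xi; exact: sqrtr_ge0.
  rewrite (swap _ _ m (fun i c x => Hfun (norm2 (T N i c x)))); last 2 first.
  - by move=> i c; exact: measurable_Hfun.
  - by move=> i c x; exact: Hfun_ge0.
  have IH0 i c : (0 <= \int[m]_x (Hfun (norm2 (T N i c x)))%:E)%E.
    by apply: integral_ge0 => x _; rewrite lee_fin Hfun_ge0.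
  rewrite ge0_sume_distrr; last first.
    by move=> i _; apply: sume_ge0 => c _; apply: mule_ge0.
  apply: lee_sum => i _; rewrite ge0_sume_distrr; last first.
    by move=> c _; apply: mule_ge0.
  apply: lee_sum => c _; rewrite muleCA; apply: lee_wpmul2l => //.
  exact: CP.
have err : \forall xi \ae mu, forall k,
    pairing xi (cell_error D J T xs N k) @[N --> \oo] --> (0 : R).
  apply: ae_foralln => k.
  (* Stage [N] approximates only the first [N] functions of the dense family; the finitely many
     earlier stages are replaced by 0. *)
  pose f N : borel_type (dist M n.-1) -> R := if (k < N)%N
    then (fun xi => Num.sqrt `|pairing xi (cell_error D J T xs N k)|) else cst
      0.
  have : \forall xi \ae mu, f N xi @[N --> \oo] --> (0 : R).
    apply: (@ae_summable_cvg0 _ _ _ mu _ C).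
    - by move=> N; rewrite /f; case: ifP => _;
        [exact: msq|exact: measurable_cst].
    - by move=> N xi; rewrite /f; case: ifP => _ //; exact: sqrtr_ge0.
    move=> N; rewrite /f; case: ifPn => kN; last first.
      by rewrite integral0 lee_fin mulr_ge0 ?exprn_ge0.
    apply: le_trans (CP _) _; rewrite EFinM; apply: lee_wpmul2l;
      first by rewrite lee_fin.
    exact: (JTxP N).1.
  apply: filterS => xi fxi.
  (* The moment bound concerns the square root of the error; squaring recovers the error. *)
  have f2 : f N xi * f N xi @[N --> \oo] --> (0 : R).
    by rewrite -[X in _ --> X](mul0r 0); apply: cvgM.
  apply/cvgrPdist_le => e e_gt0.
  have /cvgrPdist_le/(_ _ e_gt0)[N0 _ HN0] := f2.
  exists (maxn N0 k.+1) => // N /=; rewrite geq_max => /andP[N0N kN].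
  have := HN0 N N0N; rewrite /f kN !sub0r !normrN -expr2 sqr_sqrtr//.
  by rewrite normr_id.
apply: negligibleS (negligibleU often err) => xi nxi.
have [[B HB]|] := pselect (exists B : R, forall N0, exists2 N, (N0 <= N)%N &
    weighted_sqrt W J T xs N xi <= B); last by left.
right => Herr; apply: nxi.
exact: (atomic_of_limits cW denseD HB Herr).
Qed.
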